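(* Let $X$ be an h-homogeneous zero-dimensional compact Hausdorff topological space and let $G=\mathrm{Homeo}(X)$ be equipped with the compact-open topology. Then the universal minimal $G$-space $M(G)$ is isomorphic (as a $G$-space) to $\Phi(X)$, the space of maximal chains on $X$.
   Context: A zero-dimensional compact Hausdorff space $X$ is h-homogeneous if every nonempty clopen subset of $X$ is homeomorphic to $X$. For a compact Hausdorff space $X$, $\mathrm{Exp}(X)$ denotes the space of nonempty closed subsets of $X$ with the Vietoris topology. A chain is a subset $C\subset \mathrm{Exp}(X)$ such that for any $E,F\in C$ either $E\subset F$ or $F\subset E$; it is maximal if it is maximal under inclusion among chains. $\Phi(X)$ is the set of all maximal chains, a closed (hence compact) subset of $\mathrm{Exp}(\mathrm{Exp}(X))$ (Vietoris topology), with the $G$-action $g c=\{gF: F\in c\}$. For a topological group $G$, a compact Hausdorff $G$-space is minimal if it has no nonempty proper closed invariant subsets; the universal minimal $G$-space $M(G)$ is the (unique up to isomorphism) minimal $G$-space which admits a continuous $G$-equivariant surjection onto every minimal $G$-space. *)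

(* Defs.v *)
From HB Require Import structures.
From mathcomp Require Import all_boot all_algebra.
From mathcomp Require Import all_classical topology.

Set Implicit Arguments.
Unset Strict Implicit.
Unset Printing Implicit Defensive.

Local Open Scope classical_set_scope.

Definition homeo {X : topologicalType} (f : X -> X) : Prop :=
  continuous f /\ exists g : X -> X, [/\ continuous g, cancel f g & cancel g f].

Definition zero_dim (X : topologicalType) : Prop :=
  forall (x : X) (U : set X), nbhs x U ->
    exists V : set X, [/\ clopen V, V x & V `<=` U].

Definition homeomorphic_to_whole {X : topologicalType} (A : set X) : Prop :=
  exists (f g : X -> X),
    [/\ {within A, continuous f}, continuous g,
        (forall x, A x -> g (f x) = x) &
        (forall y, A (g y) /\ f (g y) = y)].

Definition h_homogeneous (X : topologicalType) : Prop :=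
  forall A : set X, clopen A -> A !=set0 -> homeomorphic_to_whole A.

Definition vietoris (T : topologicalType) : Type := set T.

HB.instance Definition _ (T : topologicalType) :=
  Choice.on (vietoris T).

Definition vietoris_subbase (T : topologicalType) (p : bool * set T) :
    set (vietoris T) :=
  if p.1 then [set F : set T | F `<=` p.2]
  else [set F : set T | F `&` p.2 !=set0].

HB.instance Definition _ (T : topologicalType) :=
  isSubBaseTopological.Build (vietoris T)
    (fun p : bool * set T => open p.2) (@vietoris_subbase T).

Definition ExpS (X : topologicalType) : set (vietoris X) :=
  [set F : set X | F !=set0 /\ closed F].

Definition Exp2 (X : topologicalType) : Type :=
  vietoris (subspace (@ExpS X)).

Definition is_chain {X : topologicalType} (c : set (set X)) : Prop :=
  c `<=` @ExpS X /\
  (forall E F, c E -> c F -> E `<=` F \/ F `<=` E).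

Definition maximal_chain {X : topologicalType} (c : set (set X)) : Prop :=
  is_chain c /\ (forall d : set (set X), is_chain d -> c `<=` d -> d = c).

Definition Phi (X : topologicalType) : set (Exp2 X) :=
  [set c : Exp2 X | maximal_chain (c : set (set X))].

Definition phi_act {X : topologicalType} (g : X -> X) (c : Exp2 X) : Exp2 X :=
  [set (g @` F) | F in (c : set (set X))].

(** ** G-spaces for G = Homeo(X) with the compact-open topology.
    A G-space is given by a subset S of a topological space T (carrying the
    subspace topology) and an action [act]; elements of G are the
    homeomorphisms of X, and G carries the subspace topology of
    {compact-open, X -> X}.  The action must be continuous jointly on
    G x S. *)
Definition is_G_space (X T : topologicalType) (S : set T)
    (act : (X -> X) -> T -> T) : Prop :=
  [/\ compact S,
      hausdorff_space (set_type S),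
      (forall g y, homeo g -> S y -> S (act g y)) &
      [/\ (forall y, S y -> act idfun y = y),
      (forall g h y, homeo g -> homeo h -> S y ->
          act (g \o h) y = act g (act h y)) &
      {within [set p : ({compact-open, X -> X} * T)%type | homeo p.1 /\ S p.2],
        continuous (fun p : ({compact-open, X -> X} * T)%type => act p.1 p.2)}]].

Definition G_invariant (X T : topologicalType) (S A : set T)
    (act : (X -> X) -> T -> T) : Prop :=
  A `<=` S /\ (forall g y, homeo g -> A y -> A (act g y)).

Definition minimal_G_space (X T : topologicalType) (S : set T)
    (act : (X -> X) -> T -> T) : Prop :=
  S !=set0 /\
  forall A : set T, G_invariant S A act -> A !=set0 ->
    closed (set_val @^-1` A : set (set_type S)) -> A = S.

Definition G_factor_map (X T1 T2 : topologicalType) (S1 : set T1) (S2 : set T2)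
    (act1 : (X -> X) -> T1 -> T1) (act2 : (X -> X) -> T2 -> T2)
    (f : T1 -> T2) : Prop :=
  [/\ {within S1, continuous f},
      (forall x, S1 x -> S2 (f x)),
      (forall y, S2 y -> exists2 x, S1 x & f x = y) &
      (forall g x, homeo g -> S1 x -> f (act1 g x) = act2 g (f x))].

(* Main.v *)
(** A maximal chain [c] linearly orders every finite clopen partition of [X]:
    [A] precedes [B] when some member of [c] meets [A] and misses [B].  The
    chain is determined by these orders, and conversely every coherent family
    of orders comes from a maximal chain, so [Phi X] is compact Hausdorff and
    has a base of sets of the form "[p] is increasing", [p] a clopen partition
    labelled by [0, ..., n-1].  As [X] is h-homogeneous, [Homeo X] is
    transitive on partitions of a given size, which gives minimality.

    For universality, let [Y] be a minimal G-space, [c0] a maximal chain and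
    [K1], [K2] disjoint closed subsets of [Y].  By compactness there is a
    partition [p] such that [p o g] decides which of [K1], [K2] the point
    [g y] can lie in, so [Y] colours labelled partitions.  The dual Ramsey
    theorem of Graham and Rothschild, transported by transitivity, and
    compactness of [Y] then give a point [y] such that [g y] and [h y] cannot
    be separated by [K1] and [K2] when [p o g] and [p o h] are both
    [c0]-increasing.  Hence [g c0 |-> g y] extends to a continuous
    equivariant map on [Phi X]; it is onto because [Y] is minimal. *)
Require Import Defs.
From HB Require Import structures.
From mathcomp Require Import all_boot all_algebra finmap.
From mathcomp Require Import all_classical topology.

Set Implicit Arguments.
Unset Strict Implicit.
Unset Printing Implicit Defensive.

(** * The dual Ramsey theorem *)

(* With the letters [0, ..., a-1] already known, every new letter of [w] is the
   least unknown one, and [b] letters are known after reading [w].  The words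
   with [rg a w (a + k)] are the k-parameter words over [0, ..., a-1], the
   parameters being written [a, ..., a + k - 1]. *)
Fixpoint rg (a : nat) (w : seq nat) (b : nat) : bool :=
  if w is x :: w' then
    if x < a then rg a w' b else (x == a) && rg a.+1 w' b
  else a == b.

(* The word [f] with its parameters [a], [a+1], ... replaced by the letters of [g]. *)
Definition sub (a : nat) (g f : seq nat) : seq nat :=
  map (nth 0 (iota 0 a ++ g)) f.

Lemma rg_leq a w b : rg a w b -> a <= b.
Proof.
elim: w a => [|x w IH] a /=; first by move/eqP->.
case: ifP => _; first exact: IH.
by case/andP=> _ /IH /ltnW.
Qed.

Lemma rg_lt a w b x : rg a w b -> x \in w -> x < b.
Proof.
elim: w a => [|y w IH] a //=; rewrite inE.
case: ifP => ya; last case/andP=> /eqP ?.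
  by move=> h /orP[/eqP->|/(IH _ h) //]; apply: leq_trans ya (rg_leq h).
by subst y => h /orP[/eqP->|/(IH _ h) //]; apply: rg_leq h.
Qed.

Lemma rg_cat a u c v b : rg a u c -> rg a (u ++ v) b = rg c v b.
Proof.
elim: u a => [|x u IH] a /=; first by move/eqP->.
by case: ifP => _; [exact: IH|case/andP=> -> /IH].
Qed.

Lemma rg_const a w : all (fun x => x < a) w -> rg a w a.
Proof. by elim: w => //= x w IH /andP[-> /IH]. Qed.

Lemma rg_size a w b : rg a w b -> b <= a + size w.
Proof.
elim: w a => [|x w IH] a /=; first by move/eqP->; rewrite addn0.
case: ifP => _; last case/andP=> _.
  by move/IH => h; apply: leq_trans h _; rewrite addnS.
by move/IH; rewrite addSnnS.
Qed.

Lemma rg_iota a m : rg a (iota a m) (a + m).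
Proof.
elim: m a => [|m IH] a /=; first by rewrite addn0.
by rewrite ltnn eqxx addnS -addSn IH.
Qed.

Lemma rg_split a f b x : rg a f b -> a <= x < b ->
  exists p q, [/\ f = p ++ x :: q, rg a p x & rg x.+1 q b].
Proof.
elim: f a => [|y f IH] a /=.
  by move/eqP-> => /andP[h1 h2]; move: (leq_trans h2 h1); rewrite ltnn.
case: ifP => ya.
  move=> h /(IH _ h) [p [q [-> h1 h2]]].
  by exists (y :: p), q; split=> //=; rewrite ya.
case/andP=> /eqP -> h /andP[ax xb]; case: (ltngtP a x) ax => // [ax _|<- _].
  have [|p [q [-> h1 h2]]] := IH _ h; first by rewrite ax.
  by exists (a :: p), q; split=> //=; rewrite ltnn eqxx.
by exists [::], f; split=> //=.
Qed.

(** The first [a] entries of [G] count as known letters. The first occurrences of [a], [a+1], ... in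
    [f] read off [drop a G] in order, and every other letter of [f] repeats a known one. *)
Lemma map_rg a f b (G : seq nat) d d' :
  rg a f b -> size G = b -> (forall i, i < a -> nth 0 G i < d) ->
  rg d (drop a G) d' -> rg d (map (nth 0 G) f) d'.
Proof.
move=> + sG; elim: f a d => [|x f IH] a d /=.
  by move/eqP-> => _; rewrite drop_oversize // sG.
case: ifP => xa.
  by move=> h ha hd; rewrite ha //; apply: IH ha hd.
case/andP=> /eqP -> h ha.
have aG : a < size G by rewrite sG (rg_leq h).
rewrite (drop_nth 0 aG) /=; case: ifP => hx.
  apply: IH => // i; rewrite ltnS leq_eqVlt => /orP[/eqP->//|]; exact: ha.
case/andP=> /eqP e hd; rewrite e eqxx /=; apply: IH hd => // i.
by rewrite ltnS leq_eqVlt => /orP[/eqP->|/ha /ltnW //]; rewrite e ltnS.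
Qed.

Lemma nth_env_lt a g x : x < a -> nth 0 (iota 0 a ++ g) x = x.
Proof. by move=> h; rewrite nth_cat size_iota h nth_iota. Qed.

Lemma sub_rg a f m g b : rg a f (a + m) -> size g = m -> rg a g b ->
  rg a (sub a g f) b.
Proof.
move=> h sg hg; apply: map_rg h _ _ _; first by rewrite size_cat size_iota sg.
  by move=> i ia; rewrite nth_env_lt.
by rewrite drop_cat size_iota ltnn subnn drop0.
Qed.

Lemma size_sub a g f : size (sub a g f) = size f.
Proof. exact: size_map. Qed.

Lemma sub_cat a g u v : sub a g (u ++ v) = sub a g u ++ sub a g v.
Proof. exact: map_cat. Qed.

Lemma sub_sub a f m g h : rg a f (a + m) -> size g = m ->
  sub a h (sub a g f) = sub a (sub a h g) f.
Proof.
move=> hf sg; rewrite /sub -map_comp; apply/eq_in_map => x /(rg_lt hf) xm /=.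
have [xa|ax] := ltnP x a; first by rewrite !nth_env_lt.
have e l : nth 0 (iota 0 a ++ l) x = nth 0 l (x - a).
  by rewrite nth_cat size_iota ltnNge ax.
by rewrite !e [RHS](nth_map 0) // sg ltn_subLR.
Qed.

Lemma sub_const a g u : rg a u a -> sub a g u = u.
Proof.
move=> h; rewrite /sub -[RHS]map_id; apply/eq_in_map => x /(rg_lt h) xa.
exact: nth_env_lt.
Qed.

Lemma sub_prefix a p i u v : rg a p (a + i) -> size u = i ->
  sub a (u ++ v) p = sub a u p.
Proof.
move=> h su; apply/eq_in_map => x /(rg_lt h) xi.
by rewrite catA nth_cat size_cat size_iota su xi.
Qed.

Lemma nth_env a i u y v : size u = i -> nth 0 (iota 0 a ++ u ++ y :: v) (a + i) = y.
Proof.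
by move=> su; rewrite catA nth_cat size_cat size_iota su ltnn subnn.
Qed.

Lemma sub_split a p i q u y v : rg a p (a + i) -> size u = i ->
  sub a (u ++ y :: v) (p ++ (a + i) :: q) =
  sub a u p ++ y :: sub a (u ++ y :: v) q.
Proof. by move=> h su; rewrite sub_cat /= (sub_prefix _ h su) nth_env. Qed.

(** * The Hales-Jewett theorem *)

(** Packs the colours of all words of length [n] over [b+1] letters into one element of a finite
    type, so that it can itself serve as a colour. The successor lets [inord] build letters. *)
Definition table (T : finType) n b (c : seq nat -> T) :
  {ffun n.-tuple 'I_b.+1 -> T} := [ffun v => c (map (@nat_of_ord _) (tval v))].

Lemma tableP (T : finType) n b (c c' : seq nat -> T) v :
  table n b c = table n b c' -> size v = n -> all (fun x => x < b.+1) v -> c v = c' v.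
Proof.
move=> /ffunP e sv av; have sz : size (map (@inord b) v) == n by rewrite size_map sv.
have := e (Tuple sz); rewrite !ffunE /= -map_comp.
suff -> : map (@nat_of_ord _ \o @inord b) v = v by [].
by rewrite -[RHS]map_id; apply/eq_in_map => y /(allP av) yb /=; rewrite inordK.
Qed.

Lemma hales_jewett a (T : finType) : exists n, forall chi : seq nat -> T,
  exists f, [/\ size f = n, rg a f a.+1 &
    forall x y, x < a -> y < a -> chi (sub a [:: x] f) = chi (sub a [:: y] f)].
Proof.
elim: a T => [|[_|a IH]] T.
- by exists 1 => chi; exists [:: 0].
- by exists 1 => chi; exists [:: 1]; split=> // [[|x] [|y]].
have: 0 < a.+1 by []; move: (a.+1) IH => {a} b IH b0.
(* Colour focusing: either a monochromatic line, or [s] lines through a common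
   point [p] at the letter [b], with distinct colours on the letters below [b]. *)
suff: forall s, exists n, forall chi : seq nat -> T,
  (exists f, [/\ size f = n, rg b.+1 f b.+2 & forall x y, x < b.+1 -> y < b.+1 ->
     chi (sub b.+1 [:: x] f) = chi (sub b.+1 [:: y] f)]) \/
  exists p (L : seq (T * seq nat)),
   [/\ size L = s, uniq (map fst L), size p = n, all (fun x => x < b.+1) p &
     forall t f, (t, f) \in L -> [/\ size f = n, rg b.+1 f b.+2,
     sub b.+1 [:: b] f = p & forall x, x < b -> chi (sub b.+1 [:: x] f) = t]].
  (* That many focused lines would need more than [#|T|] distinct colours, so the first alternative
     holds. *)
  case/(_ #|T|.+1)=> n hn; exists n => chi; case: (hn chi) => // -[p [L [sL uL _ _ _]]].
  have := max_card (mem (map fst L)); rewrite (card_uniqP uL) size_map sL.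
  by rewrite ltnn.
elim=> [|s [n hn]].
  by exists 0 => chi; right; exists [::], [::].
(* The induction hypothesis is applied to the first [m] places, a word being coloured by the whole
   colouring it induces on the last [n]. So on the line [f0] all letters below [b] are
   interchangeable. *)
have [m hm] := IH {ffun n.-tuple 'I_b.+1 -> T}.
exists (m + n) => chi.
have [f0 [sf0 rf0 cf0]] := hm (fun u => table n b (fun v => chi (u ++ v))).
have {}cf0 x v : x < b -> size v = n -> all (fun x => x < b.+1) v ->
    chi (sub b [:: x] f0 ++ v) = chi (sub b [:: 0] f0 ++ v).
  by move=> xb; have /tableP -/(_ v) := cf0 x 0 xb b0.
(* The parameter [b] of [f0] is a letter of the larger alphabet, hence is renamed [b+1]. *)
have rf1 : rg b.+1 (sub b [:: b.+1] f0) b.+2.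
  apply: map_rg rf0 _ _ _; first by rewrite size_cat size_iota addn1.
    by move=> i ib; rewrite nth_env_lt // ltnS ltnW.
  by rewrite drop_cat size_iota ltnn subnn /= ltnn !eqxx.
have en c y : nth 0 (iota 0 c ++ [:: y]) c = y.
  by rewrite nth_cat size_iota ltnn subnn.
have e1 x : sub b.+1 [:: x] (sub b [:: b.+1] f0) = sub b [:: x] f0.
  rewrite /sub -map_comp; apply/eq_in_map => y /(rg_lt rf0).
  rewrite [(_ \o _) y]/comp ltnS leq_eqVlt => /orP[/eqP->|yb].
    by rewrite !en.
  by rewrite (nth_env_lt _ yb) !nth_env_lt // ltnW.
have rsub x f : x < b.+1 -> rg b.+1 f b.+2 -> all (fun x => x < b.+1) (sub b.+1 [:: x] f).
  move=> xb rf; apply/allP => y; apply: rg_lt (_ : rg b.+1 _ b.+1).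
  by apply: (@sub_rg _ _ 1) => //; rewrite ?addn1 //= xb eqxx.
case: (hn (fun v => chi (sub b [:: 0] f0 ++ v))) => [[f [sf rf cf]]|].
  left; exists (sub b [:: 0] f0 ++ f); rewrite size_cat size_sub sf0 sf.
  have r0 : rg b.+1 (sub b [:: 0] f0) b.+1.
    by rewrite -e1; apply: (@sub_rg _ _ 1) => //; rewrite ?addn1 //= eqxx.
  split=> //; first by rewrite (rg_cat _ _ r0).
  by move=> x y xb yb; rewrite !sub_cat !(sub_const _ r0) (cf x y).
case=> p [L [sL uL sp ap hL]].
have key t f : (t, f) \in L -> forall x, x < b ->
    chi (sub b [:: x] f0 ++ sub b.+1 [:: x] f) = t.
  move=> tf x xb; have [sf rf fp cf] := hL _ _ tf.
  by rewrite cf0 ?size_sub ?rsub ?cf // ltnS ltnW.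
(* If the focus, preceded by [f0] at 0, has the colour of one of the lines, that line keeps its
   colour at the letter [b] too. *)
have [hp|hp] := boolP (chi (sub b [:: 0] f0 ++ p) \in map fst L).
  left; case/mapP: hp => -[t f] tf /= e.
  have [sf rf fp cf] := hL _ _ tf.
  have r0 : rg b.+1 (sub b [:: 0] f0) b.+1.
    by rewrite -e1; apply: (@sub_rg _ _ 1) => //; rewrite ?addn1 //= eqxx.
  exists (sub b [:: 0] f0 ++ f); rewrite size_cat size_sub sf0 sf.
  split=> //; first by rewrite (rg_cat _ _ r0).
  have h x : x < b.+1 -> chi (sub b.+1 [:: x] (sub b [:: 0] f0 ++ f)) = t.
    rewrite sub_cat (sub_const _ r0) ltnS leq_eqVlt => /orP[/eqP->|]; last exact: cf.
    by rewrite fp.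
  by move=> x y xb yb; rewrite !h.
(* Otherwise the focus moves to [f0] at [b] followed by [p]. The old lines are prefixed with [f0],
   sharing their parameter, and [f0] followed by the constant [p] is a line of the new colour. *)
right; exists (sub b [:: b] f0 ++ p).
exists ((chi (sub b [:: 0] f0 ++ p), sub b [:: b.+1] f0 ++ p) ::
  [seq (tf.1, sub b [:: b.+1] f0 ++ tf.2) | tf <- L]).
have rp : rg b.+1 p b.+1 by exact: rg_const.
split=> /=; rewrite ?size_map ?sL ?size_cat ?size_sub ?sf0 ?sp //.
- by rewrite -map_comp /= uL andbT; move: hp; congr (_ \notin _); exact/eq_map.
- by rewrite all_cat ap -e1 rsub.
have rF f : all (fun x => x < b.+2) f -> rg b.+1 (sub b [:: b.+1] f0 ++ f) b.+2.
  by move=> rf; rewrite (rg_cat _ _ rf1) rg_const.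
move=> t f; rewrite inE => /orP[/eqP[-> ->]|/mapP[[t' f'] tf [-> ->]]] /=.
  rewrite size_cat size_sub sf0 sp rF; last first.
    by apply: sub_all ap => x /ltnW.
  rewrite sub_cat e1 (sub_const _ rp); split=> // x xb.
  by rewrite sub_cat e1 (sub_const _ rp) cf0.
have [sf rf fp cf] := hL _ _ tf.
rewrite size_cat size_sub sf0 sf rF; last by apply/allP => x; apply: rg_lt rf.
by rewrite sub_cat e1 fp; split=> // x xb; rewrite sub_cat e1 (key t').
Qed.

(* [f] with its parameters shifted by one, after a new first parameter. *)
Definition lift_word a m f := a :: sub a (iota a.+1 m) f.

Lemma lift_word_rg a m f : rg a f (a + m) -> rg a (lift_word a m f) (a + m.+1).
Proof.
move=> h; rewrite /= ltnn eqxx /=.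
apply: map_rg h _ _ _; first by rewrite size_cat !size_iota.
  by move=> i ia; rewrite nth_env_lt // ltnW.
by rewrite drop_cat size_iota ltnn subnn drop0 addnS -addSn rg_iota.
Qed.

Lemma sub_lift_word a m f x g : rg a f (a + m) -> size g = m ->
  sub a (x :: g) (lift_word a m f) = x :: sub a g f.
Proof.
move=> h sg; rewrite /=; congr cons.
  by have := @nth_env a 0 [::] x g erefl; rewrite addn0.
rewrite /sub -map_comp; apply/eq_in_map => y /(rg_lt h) ym.
rewrite [(_ \o _) y]/comp; have [ya|ay] := ltnP y a.
  by rewrite !nth_env_lt.
have e l : nth 0 (iota 0 a ++ l) y = nth 0 l (y - a).
  by rewrite nth_cat size_iota ltnNge ay.
rewrite !e nth_iota ?ltn_subLR // nth_cat size_iota ltnNge.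
by rewrite addSn subnKC // leqW // subSn.
Qed.

Lemma sub_cons a g f : sub a (a :: g) f = sub a.+1 g f.
Proof. by rewrite /sub -[in RHS]addn1 iotaD -catA. Qed.

Lemma sub_cons_head a g f : sub a (a :: g) (a :: f) = a :: sub a.+1 g f.
Proof. by rewrite sub_cons {1}/sub [LHS]/map nth_env_lt. Qed.

(** * The Graham-Rothschild theorem on parameter words *)

Definition graham_rothschild_at k := forall a m (T : finType), exists n,
  forall chi : seq nat -> T, exists f, [/\ size f = n, rg a f (a + m) &
  forall g g', size g = m -> size g' = m -> rg a g (a + k) -> rg a g' (a + k) ->
    chi (sub a g f) = chi (sub a g' f)].

(** This is the multidimensional Hales-Jewett theorem. Each new parameter is a line [f1] put in
    front, chosen for the tables of colours of the remaining places, so that its letter does not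
    matter. *)
Lemma graham_rothschild0 : graham_rothschild_at 0.
Proof.
move=> a m T; elim: m => [|m [n2 h2]].
  by exists 0 => chi; exists [::]; rewrite addn0; split=> //= -[|//] [|].
have [n1 h1] := hales_jewett a {ffun n2.-tuple 'I_a.+1 -> T}.
exists (n1 + n2) => chi.
have [f1 [s1 r1 c1]] := h1 (fun u => table n2 a (fun v => chi (u ++ v))).
have [f2 [s2 r2 c2]] := h2 (fun v => chi (sub a [:: 0] f1 ++ v)).
have rs : rg a.+1 (sub a (iota a.+1 m) f2) (a + m.+1).
  by have := lift_word_rg r2; rewrite /= ltnn eqxx.
exists (f1 ++ sub a (iota a.+1 m) f2); rewrite size_cat size_sub s1 s2.
split=> //; first by rewrite (rg_cat _ _ r1).
suff key x g : size g = m -> x < a -> rg a g a ->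
    chi (sub a (x :: g) (f1 ++ sub a (iota a.+1 m) f2)) =
    chi (sub a [:: 0] f1 ++ sub a g f2).
  move=> [|x g] [|x' g'] //= [sg] [sg']; rewrite addn0.
  case: ifP => [xa|_]; last by case/andP=> _ /rg_leq; rewrite ltnn.
  case: ifP => [xa' h h'|_ _]; last by case/andP=> _ /rg_leq; rewrite ltnn.
  by rewrite !key //; apply: c2; rewrite ?addn0.
move=> sg xa rgg; rewrite sub_cat (_ : sub a (x :: g) f1 = sub a [:: x] f1); last first.
  by rewrite -[x :: g]/([:: x] ++ g) (@sub_prefix _ _ 1) // addn1.
have [_ ->] := sub_lift_word x r2 sg.
have /tableP -/(_ (sub a g f2)) := c1 x 0 xa (leq_ltn_trans (leq0n _) xa).
apply; first by rewrite size_sub.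
apply/allP => y; have := sub_rg r2 sg rgg => /rg_lt h /h ya; exact: ltnW.
Qed.

Definition prefix_of (f : seq nat) x := take (index x f) f.

Lemma prefix_ofE a p x q : rg a p x -> prefix_of (p ++ x :: q) x = p.
Proof.
move=> h; have xp : x \notin p by apply/negP => /(rg_lt h); rewrite ltnn.
by rewrite /prefix_of index_cat (negbTE xp) /= eqxx addn0 take_size_cat.
Qed.

(** The last parameter is put at the very end, so that its prefix is a whole word, handled by
    [graham_rothschild0]. The earlier prefixes come from prefixes of [f], whose colours define the
    colouring given to the induction hypothesis. *)
Lemma prefix_colour_each a m (T : finType) : exists n, forall chi : seq nat -> T,
  exists f, [/\ size f = n, rg a f (a + m) & forall i, i < m ->
    exists p q, [/\ f = p ++ (a + i) :: q, rg a p (a + i) &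
      forall u u', size u = i -> size u' = i -> rg a u a -> rg a u' a ->
        chi (sub a u p) = chi (sub a u' p)]].
Proof.
elim: m => [|m [N hN]].
  by exists 0 => chi; exists [::]; rewrite addn0 /= eqxx; split.
have [n hn] := graham_rothschild0 a N T.
exists n.+1 => chi; have [f [sf rf cf]] := hn chi.
have [g [sg rgg cg]] := hN (fun w => chi (sub a w (prefix_of f (a + size w)))).
have rfg := sub_rg rf sg rgg.
exists (sub a g f ++ [:: a + m]); split.
- by rewrite size_cat size_sub sf addn1.
- rewrite (rg_cat _ _ rfg) /= ltnn !eqxx /= addnS eqxx //.
move=> i; rewrite ltnS leq_eqVlt => /orP[/eqP->|im].
  exists (sub a g f), [::]; split=> // u u' su su' ru ru'.
  rewrite !(sub_sub _ rf) //; apply: cf; rewrite ?size_sub ?addn0 //.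
    exact: sub_rg rgg su ru.
  exact: sub_rg rgg su' ru'.
have [p1 [q1 [eg rp1 cp1]]] := cg i im.
have sp1 : size p1 < N by rewrite -sg eg size_cat /= -addSnnS leq_addr.
have [|p2 [q2 [ef rp2 _]]] := rg_split (x := a + size p1) rf.
  by rewrite leq_addr ltn_add2l.
exists (sub a p1 p2), (sub a g q2 ++ [:: a + m]); split.
- by rewrite {1}ef {1}eg (sub_split _ _ _ rp2) // -eg -catA.
- exact: sub_rg rp2 _ rp1.
move=> u u' su su' ru ru'; have := cp1 u u' su su' ru ru'.
by rewrite !size_sub ef !(prefix_ofE _ rp2) !(sub_sub _ rp2).
Qed.

(** The first [m] places satisfying [P] become the parameters and all others get the letter 0,
    available because [0 < a]. *)
Lemma select_word a (P : pred nat) m M : 0 < a -> m <= count P (iota 0 M) ->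
  exists h, [/\ size h = M, rg a h (a + m) & forall i, i < m ->
    exists p q, [/\ h = p ++ (a + i) :: q, rg a p (a + i) & P (size p)]].
Proof.
move=> a0; elim: M m => [|M IH] m.
  by rewrite leqn0 => /eqP->; exists [::]; rewrite addn0 /= eqxx.
rewrite -addn1 iotaD count_cat /= addn0 add0n => hm.
have [h|] := leqP m (count P (iota 0 M)).
  have [w [sw rw cw]] := IH _ h; exists (w ++ [:: 0]); split.
  - by rewrite size_cat sw.
  - by rewrite (rg_cat _ _ rw) /= addn_gt0 a0 eqxx.
  move=> i /cw [p [q [-> rp Pp]]].
  by exists p, (q ++ [:: 0]); rewrite -catA.
case: (P M) / boolP hm => PM; last by rewrite addn0 leqNgt => /negbTE->.
case: m => // m; rewrite [_ + true]addn1 ltnS => h1 _.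
have [w [sw rw cw]] := IH _ h1; exists (w ++ [:: a + m]); split.
- by rewrite size_cat sw addn1.
- by rewrite (rg_cat _ _ rw) /= ltnn !eqxx addnS eqxx.
move=> i; rewrite ltnS leq_eqVlt => /orP[/eqP->|/cw [p [q [-> rp Pp]]]].
  by exists w, [::]; rewrite sw.
by exists p, (q ++ [:: a + m]); rewrite -catA.
Qed.

Lemma size_count (T : finType) (s : seq T) : size s = \sum_t count_mem t s.
Proof.
elim: s => [|x s IH] /=; first by rewrite big1.
rewrite big_split /= -IH (bigD1 x) //= eqxx big1 // => t /negbTE.
by rewrite eq_sym => ->.
Qed.

Lemma pigeonhole (T : finType) (s : seq T) m : 0 < #|T| -> m * #|T| <= size s ->
  exists t, m <= count_mem t s.
Proof.
move=> T0; case: m => [|m] h; first by case/card_gt0P: T0 => t _; exists t.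
apply/existsP; rewrite -[X in is_true X]negbK negb_exists; apply/negP => /forallP hs.
move: h; rewrite size_count leqNgt => /negP; apply.
apply: leq_ltn_trans (_ : m * #|T| < _); last by rewrite ltn_mul2r T0 ltnSn.
rewrite mulnC -sum_nat_const; apply: leq_sum => t _.
by have := hs t; rewrite -ltnNge ltnS.
Qed.

(** Among [m * #|T|] parameters with a prefix colour each, [m] share their colour; [select_word]
    keeps these and sets the others to 0. *)
Lemma prefix_colour a m (T : finType) : 0 < a -> exists n, forall chi : seq nat -> T,
  exists f t, [/\ size f = n, rg a f (a + m) & forall i, i < m ->
    exists p q, [/\ f = p ++ (a + i) :: q, rg a p (a + i) &
      forall u, size u = i -> rg a u a -> chi (sub a u p) = t]].
Proof.
move=> a0; pose M := m * #|T|; have [n hn] := prefix_colour_each a M T.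
exists n => chi; have [f [sf rf cf]] := hn chi.
pose col i := chi (sub a (nseq i 0) (prefix_of f (a + i))).
have [||t] := @pigeonhole _ (map col (iota 0 M)) m.
- by apply/card_gt0P; exists (chi [::]).
- by rewrite size_map size_iota.
rewrite count_map => /(select_word a0) [h [sh rh ch]].
exists (sub a h f), t; rewrite size_sub; split=> //; first exact: sub_rg rf sh rh.
move=> i im; have [p1 [q1 [eh rp1 /eqP cp1]]] := ch i im.
have sp1 : size p1 < M by rewrite -sh eh size_cat /= -addSnnS leq_addr.
have [p2 [q2 [ef rp2 cp2]]] := cf _ sp1.
exists (sub a p1 p2), (sub a h q2); split.
- by rewrite {1}ef {1}eh (sub_split _ _ _ rp2) // -eh.
- exact: sub_rg rp2 _ rp1.
move=> u su ru; rewrite (sub_sub _ rp2) // -cp1 /col ef (prefix_ofE _ rp2).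
apply: cp2; rewrite ?size_sub ?size_nseq //; first exact: sub_rg rp1 su ru.
by apply: rg_const; rewrite all_nseq a0 orbT.
Qed.

(** After its first new letter [a], a word with [k+1] new letters is a k-parameter word over [a+1]
    letters, so the case [k] removes the dependence on that suffix. The places of this first new
    letter are treated one after the other. *)
Lemma suffix_colour k a M (T : finType) : graham_rothschild_at k ->
  exists n, forall chi : seq nat -> T, exists f, [/\ size f = n, rg a f (a + M) &
    forall u v v', rg a u a -> size u + (size v).+1 = M -> size v' = size v ->
      rg a.+1 v (a.+1 + k) -> rg a.+1 v' (a.+1 + k) ->
      chi (sub a (u ++ a :: v) f) = chi (sub a (u ++ a :: v') f)].
Proof.
move=> GR; elim: M T => [|M IH] T.
  exists 0 => chi; exists [::]; rewrite addn0 /= eqxx; split=> // u v v' _; rewrite addnS.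
have [M' hM'] := IH {ffun 1.-tuple 'I_a.+1 -> T}.
have [n1 hn1] := GR a.+1 M' T.
exists n1.+1 => chi.
(* [f1] settles the case of empty [u]; [f] below settles a nonempty [u], whose first letter is the
   argument of the table. *)
have [f1 [s1 r1 c1]] := hn1 (fun w => chi (a :: w)).
have R1 : rg a (a :: f1) (a + M'.+1) by rewrite /= ltnn eqxx addnS.
have [f [sf rf cf]] := hM' (fun w => table 1 a (fun x => chi (sub a (x ++ w) (a :: f1)))).
have sl : size (lift_word a M f) = M'.+1 by rewrite /= size_sub sf.
exists (sub a (lift_word a M f) (a :: f1)); split.
- by rewrite size_sub /= s1.
- exact: sub_rg R1 sl (lift_word_rg rf).
move=> [|x u] v v'; rewrite ?cat0s ?cat_cons.
  move=> _ [sv] sv' rv rv'; rewrite !(sub_sub _ R1) // !(sub_lift_word _ rf) ?sv' //.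
  rewrite !sub_cons_head.
  have rr w : size w = M -> rg a.+1 w (a.+1 + k) -> rg a.+1 (sub a w f) (a.+1 + k).
    move=> sw rw; apply: map_rg rf _ _ _; first by rewrite size_cat size_iota sw.
      by move=> i ia; rewrite nth_env_lt // ltnW.
    by rewrite drop_cat size_iota ltnn subnn drop0.
  by apply: c1; rewrite ?size_sub ?rr // sv'.
rewrite [rg a (x :: u) a]/= [size _]/= addSn.
case: ifP => [xa ru|_]; last by case/andP=> _ /rg_leq; rewrite ltnn.
move=> [sv] sv' rv rv'.
rewrite !(sub_sub _ R1) // !(sub_lift_word _ rf) ?size_cat /= ?sv' //.
have := cf u v v' ru sv sv' rv rv' => /tableP -/(_ [:: x]) /=; apply=> //.
by rewrite ltnS ltnW.
Qed.

(** A word with [k+1] new letters is split at the first one as [u ++ a :: v]. The colour is made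
    independent of [v] by [suffix_colour], then of [u] and its length by [prefix_colour]. *)
Lemma graham_rothschild k : graham_rothschild_at k.
Proof.
elim: k => [|k GR]; first exact: graham_rothschild0.
move=> [|a] m T.
  (* Over the empty alphabet a nonempty parameter word starts with 0. Removing it leaves a word over
     one letter with one parameter less. *)
  case: m => [|m].
    by exists 0 => chi; exists [::]; split=> // -[|//] [|].
  have [n hn] := GR 1 m T; exists n.+1 => chi.
  have [f [sf rf cf]] := hn (fun w => chi (0 :: w)).
  exists (0 :: f); rewrite /= sf; split=> // -[|x g] [|x' g'] //= [sg] [sg'].
  case/andP=> /eqP-> rgg /andP[/eqP-> rgg'].
  by rewrite -!/(sub 0 (0 :: _) f) !sub_cons; apply: cf.
set b := a.+1; have b0 : 0 < b by []; move: b b0 => {}a a0.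
have [M hM] := prefix_colour m T a0; have [n hn] := suffix_colour a M T GR.
exists n => chi; have [f [sf rf cf]] := hn chi.
(* A sample suffix with [k] new letters, padded with 0 to the length left after [u]; by [cf] any
   other suffix gives the same colour. *)
pose v0 (u : seq nat) := iota a.+1 k ++ nseq (M - (size u).+1 - k) 0.
have [h [t [sh rh ch]]] := hM (fun u => chi (sub a (u ++ a :: v0 u) f)).
suff key g : size g = m -> rg a g (a + k.+1) -> chi (sub a g (sub a h f)) = t.
  exists (sub a h f); rewrite size_sub; split=> //; first exact: sub_rg rf sh rh.
  by move=> g g' sg sg' rgg rgg'; rewrite !key.
move=> sg rgg; have [|u [v [eg ru rv]]] := rg_split (x := a) rgg.
  by rewrite leqnn addnS ltnS leq_addr.
have um : size u < m by rewrite -sg eg size_cat /= -addSnnS leq_addr.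
have [p [q [eh rp cp]]] := ch _ um.
have shg : sub a g h = sub a u p ++ a :: sub a g q.
  by rewrite {1}eg {1}eh (sub_split _ _ _ rp) // -eg.
have rup : rg a (sub a u p) a by exact: sub_rg rp _ ru.
have rq : rg a.+1 (sub a g q) (a.+1 + k).
  by have := sub_rg rh sg rgg; rewrite shg (rg_cat _ _ rup) /= ltnn eqxx addnS.
have sp : size p + (size q).+1 = M by rewrite -sh eh size_cat.
rewrite (sub_sub _ rf) // shg -(cp u) //.
have kq : k <= size q.
  by have := rg_size rq; rewrite size_sub leq_add2l.
have e : M - (size p).+1 = size q by rewrite -sp -addSnnS addKn.
apply: cf => //; rewrite ?size_sub ?sp // /v0 size_sub e.
  by rewrite size_cat size_iota size_nseq subnKC.
rewrite (rg_cat _ _ (rg_iota _ _)); apply: rg_const.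
by rewrite all_nseq orbT.
Qed.

(** A word with [rg 0 g k] codes a partition of its places into [k] blocks, ordered by first
    occurrence. Graham-Rothschild is applied once for each [k <= N]; passing to a subword keeps what
    was achieved for smaller [k]. *)
Theorem dual_ramsey N (T : finType) : exists M, forall chi : seq nat -> T,
  exists f, [/\ size f = M, rg 0 f N & forall k g g',
    size g = N -> size g' = N -> rg 0 g k -> rg 0 g' k ->
    chi (sub 0 g f) = chi (sub 0 g' f)].
Proof.
suff [M hM] : exists M, forall chi : seq nat -> T,
  exists f, [/\ size f = M, rg 0 f N & forall k g g', k < N.+1 ->
    size g = N -> size g' = N -> rg 0 g k -> rg 0 g' k ->
    chi (sub 0 g f) = chi (sub 0 g' f)].
  exists M => chi; have [f [sf rf cf]] := hM chi; exists f; split=> // k g g' sg sg' r r'.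
  by apply: (cf k) => //; rewrite ltnS -sg; have := rg_size r.
move: (N.+1) => K; elim: K N => [|K IH] N.
  by exists N => chi; exists (iota 0 N); rewrite size_iota rg_iota.
have [N' hN'] := graham_rothschild K 0 N T; have [M hM] := IH N'.
exists M => chi; have [f1 [s1 r1 c1]] := hM chi.
have [f2 [s2 r2 c2]] := hN' (fun w => chi (sub 0 w f1)).
exists (sub 0 f2 f1); rewrite size_sub; split=> //; first exact: sub_rg r1 s2 r2.
move=> k g g'; rewrite ltnS leq_eqVlt => hk sg sg' r r'.
rewrite !(sub_sub _ (r1 : rg 0 f1 (0 + _))) //.
case/orP: hk => [/eqP ek|hk]; first by apply: c2; rewrite ?add0n -?ek.
by apply: (c1 k); rewrite ?size_sub //; apply: sub_rg r2 _ _.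
Qed.

(** * The Vietoris topology *)

Local Open Scope classical_set_scope.

Lemma vietoris_cvg (T : topologicalType) (F : set_system (vietoris T))
    (c : vietoris T) : Filter F ->
  (forall O : set T, open O -> c `<=` O -> F [set d : vietoris T | (d : set T) `<=` O]) ->
  (forall O : set T, open O -> c `&` O !=set0 ->
     F [set d : vietoris T | (d : set T) `&` O !=set0]) ->
  F --> c.
Proof.
move=> FF h1 h2 A; rewrite nbhs_simpl /= nbhsE => -[_ [[B sB <-] [C BC Ct]] sUBA].
apply: filterS sUBA _; apply: (@filterS _ _ _ C); first by move=> ? ?; exists C.
have /sB [D sD IDeC] := BC; rewrite -IDeC; apply: filter_bigI => -[b O] DE.
have /sD := DE; rewrite inE /= => oO.
move: Ct; rewrite -IDeC => /(_ _ DE); case: b {DE} => /=.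
  exact: h1.
exact: h2.
Qed.

Lemma open_vietoris_subset (T : topologicalType) (O : set T) : open O ->
  open [set F : vietoris T | (F : set T) `<=` O].
Proof.
move=> oO; set B := [set F : vietoris T | _].
exists [set B]; last by rewrite bigcup_set1.
move=> _ ->; exists [fset (true, O)]%fset; last by rewrite set_fset1 bigcap_set1.
by move=> ?; rewrite !inE => /eqP->.
Qed.

Lemma open_vietoris_meets (T : topologicalType) (O : set T) : open O ->
  open [set F : vietoris T | (F : set T) `&` O !=set0].
Proof.
move=> oO; set B := [set F : vietoris T | _].
exists [set B]; last by rewrite bigcup_set1.
move=> _ ->; exists [fset (false, O)]%fset; last by rewrite set_fset1 bigcap_set1.
by move=> ?; rewrite !inE => /eqP->.
Qed.

(** * Maximal chains and orders on clopen sets *)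

Section Chains.
Context (X : topologicalType).
Hypotheses (cX : compact [set: X]) (hX : hausdorff_space X) (zX : zero_dim X).
Implicit Types (A B C D E F K : set X) (c d : set (set X)).

Lemma closed_compactX K : closed K -> compact K.
Proof. by move=> cK; apply: subclosed_compact cK cX _. Qed.

(** Closure of [S] under unions turns a finite subcover into a single member. Otherwise the sets
    [K \ B] would have a cluster point, lying in all of them yet in some [B]. *)
Lemma clopen_directed_cover (S : set (set X)) K :
  S set0 /\ (forall B, S B -> clopen B) ->
  (forall B C, S B -> S C -> S (B `|` C)) ->
  (forall x, K x -> exists2 B, S B & B x) -> closed K ->
  exists2 B, S B & K `<=` B.
Proof.
move=> [S0 SC] SU cov cK; apply: contrapT => nB.
pose G := filter_from S (fun B => K `\` B).
have GG : ProperFilter G.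
  apply: filter_from_proper.
    apply: filter_from_filter; first by exists set0.
    by move=> B C SB SD; exists (B `|` C); [exact: SU|move=> x [Kx /not_orP[]]].
  move=> B SB; apply/set0P/negP => /eqP; rewrite setD_eq0 => KB.
  by apply: nB; exists B.
have [x [_]] := cX GG (@filterT _ G _).
rewrite clusterE => clx.
have key B : S B -> (K `\` B) x.
  move=> SB; have cl : closed (K `\` B).
    by rewrite setDE; apply: closedI => //; apply: open_closedC; case: (SC _ SB).
  by apply: cl; apply: clx; exists B.
have [B SB Bx] := cov x (proj1 (key _ S0)).
by case: (key _ SB).
Qed.

Lemma clopen_between K O : closed K -> open O -> K `<=` O ->
  exists W, [/\ clopen W, K `<=` W & W `<=` O].
Proof.
move=> cK oO KO.
have [||||W [clW WO] KW] := @clopen_directed_cover [set B | clopen B /\ B `<=` O] K.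
- by split=> [|B []//]; split; first exact: clopen0.
- by move=> B C [? ?] [? ?]; split; [exact: clopenU|rewrite subUset].
- move=> x Kx; have /zX[V [clV Vx VO]] : nbhs x O by apply: open_nbhs_nbhs; split=> //; exact: KO.
  by exists V.
- by [].
by exists W.
Qed.

(* [A] is met no later than [B] as the members of [c] grow. *)
Definition cle c A B := forall F, c F -> F `&` B !=set0 -> F `&` A !=set0.

Lemma maximal_chain_mem c F : maximal_chain c -> ExpS F ->
  (forall E, c E -> E `<=` F \/ F `<=` E) -> c F.
Proof.
move=> [[cE cc] mc] EF hF; rewrite -(mc (c `|` [set F])); [by right| |by left].
split; first by move=> G [/cE //|->].
move=> G H [cG|->] [cH|->]; [exact: cc|exact: hF| |by left].
by case: (hF _ cH); [right|left].
Qed.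

Lemma not_cle c A B : ~ cle c A B -> exists F, [/\ c F, F `&` B !=set0 & F `&` A = set0].
Proof.
move=> /existsNP[F /not_implyP[cF /not_implyP[FB /set0P/negP]]].
by rewrite negbK => /eqP FA; exists F.
Qed.

Lemma meets_sub A B C D : A `<=` C -> B `<=` D -> A `&` B !=set0 -> C `&` D !=set0.
Proof. by move=> sAC sBD [x [/sAC ? /sBD ?]]; exists x. Qed.

Lemma cle_trans c A B C : cle c A B -> cle c B C -> cle c A C.
Proof. by move=> h1 h2 F cF /(h2 F cF); exact: h1. Qed.

Lemma cle_sub c A B : A `<=` B -> cle c B A.
Proof. by move=> AB F _; apply: meets_sub. Qed.

Lemma misses_sub A B C : A `<=` C -> C `&` B = set0 -> A `&` B = set0.
Proof. by move=> sAC CB; rewrite -subset0 -CB; exact: setSI. Qed.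

Lemma meets_misses A B : A `&` B !=set0 -> A `&` B = set0 -> False.
Proof. by move=> /set0P/negP h e; apply: h; rewrite e. Qed.

Lemma cle_total c A B : is_chain c -> cle c A B \/ cle c B A.
Proof.
move=> [_ cc]; apply: contrapT => /not_orP[h1 h2].
have [F [cF FB FA]] := not_cle h1; have [E [cE EA EB]] := not_cle h2.
case: (cc _ _ cF cE) => s.
  by case: (meets_misses FB); apply: misses_sub s EB.
by case: (meets_misses EA); apply: misses_sub s FA.
Qed.

(** If both fail, the smaller of the two witnesses meets [C] and misses [A] and [B]. *)
Lemma cle_setU c A B C : is_chain c -> cle c (A `|` B) C -> cle c A C \/ cle c B C.
Proof.
move=> [_ cc] h; apply: contrapT => /not_orP[h1 h2].
have [F [cF FC FA]] := not_cle h1; have [E [cE EC EB]] := not_cle h2.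
wlog: A B F E cF cE FC FA EC EB {h1 h2} h / F `<=` E => [wl|s].
  case: (cc _ _ cF cE) => s; first exact: (wl A B F E).
  by apply: (wl B A E F) => //; rewrite setUC.
have := h _ cF FC; rewrite setIUr FA set0U => FB.
by case: (meets_misses FB); exact: misses_sub s EB.
Qed.

Lemma maximal_chainT c : [set: X] !=set0 -> maximal_chain c -> c setT.
Proof.
move=> X0 mc; apply: maximal_chain_mem => //; by move=> E _; left.
Qed.

(** The intersection [FA] of the members meeting [A] still meets [A] by compactness. If [A] and [B]
    were met simultaneously, removing [B] from [FA] would give a set comparable with every member,
    hence a member meeting [A] and missing [B]. *)
Lemma cle_anti c A B : maximal_chain c -> clopen A -> open B -> A `&` B = set0 ->
  A !=set0 -> cle c A B -> ~ cle c B A.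
Proof.
move=> mc [oA clA] oB AB A0 hAB hBA; have [[cE cc] _] := mc.
pose S := [set F | c F /\ F `&` A !=set0].
pose FA := \bigcap_(F in S) F.
have FAc : closed FA by apply: closed_bigI => F [/cE []].
have FAA : FA `&` A !=set0.
  pose G := filter_from S (fun F => F `&` A).
  have ST : S setT.
    by case: A0 => x Ax; split; [apply: maximal_chainT => //; exists x|exists x].
  have GG : ProperFilter G.
    apply: filter_from_proper; last by move=> F [].
    apply: filter_from_filter; first by exists setT.
    move=> F E SF SE; case: (cc F E SF.1 SE.1) => s.
      by exists F => // x [Fx Ax]; split; split=> //; exact: s.
    by exists E => // x [Fx Ax]; split; split=> //; exact: s.
  have [x [_]] := cX GG (@filterT _ G _).
  rewrite clusterE => clx; exists x; split.
    move=> F SF; have [_ cF] := cE _ SF.1.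
    apply: cF; apply: closureS (clx (F `&` A) _); first by move=> ? [].
    by exists F.
  by apply: clA; apply: closureS (clx (setT `&` A) _); [move=> ? []|exists setT].
(* A member meeting [A] contains [FA]. One missing [A] also misses [B], by [hAB], and lies below
   every member meeting [A]. *)
have hF E : c E -> E `<=` (FA `\` B) \/ FA `\` B `<=` E.
  move=> cEE; have [EA|EA] := pselect (E `&` A !=set0).
    by right=> x [FAx _]; apply: FAx.
  left=> x Ex; split.
    move=> F [cF FAn]; case: (cc _ _ cEE cF) => s; first exact: s.
    by case: EA; apply: meets_sub s _ FAn.
  by move=> Bx; apply: EA; apply: hAB cEE _; exists x.
have FB0 : (FA `\` B) `&` A !=set0.
  case: FAA => x [Fx Ax]; exists x; split=> //; split=> // Bx.
  by have : (A `&` B) x by []; rewrite AB.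
have cF : c (FA `\` B).
  apply: maximal_chain_mem => //; rewrite /ExpS; split; first by case: FB0 => x [? _]; exists x.
  by apply: closedI => //; exact: open_closedC.
by case: (hBA _ cF FB0) => x [[_ nB] /nB].
Qed.

(** These axioms characterise the relations [cle c] of maximal chains, by [cle_order] and
    [cle_chain_of]. Involving clopen sets only, they pass to limits along ultrafilters. *)
Record clopen_order (R : set X -> set X -> Prop) : Prop := {
  ord_total : forall A B, clopen A -> clopen B -> R A B \/ R B A;
  ord_trans : forall A B C, clopen A -> clopen B -> clopen C -> R A B -> R B C -> R A C;
  ord_sub : forall A B, clopen A -> clopen B -> A `<=` B -> R B A;
  ord_setU : forall A B C, clopen A -> clopen B -> clopen C ->
    R (A `|` B) C -> R A C \/ R B C;
  ord_set0 : forall B, clopen B -> R set0 B -> B = set0;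
  ord_anti : forall A B, clopen A -> clopen B -> A `&` B = set0 -> A !=set0 ->
    R A B -> ~ R B A }.

Definition chain_of (R : set X -> set X -> Prop) : set (set X) :=
  [set F | @ExpS X F /\ forall A B, clopen A -> clopen B -> R A B ->
     F `&` B !=set0 -> F `&` A !=set0].

Lemma cle_set0 c B : maximal_chain c -> cle c set0 B -> B = set0.
Proof.
move=> mc h; apply/eqP/negPn/negP => /set0P[x Bx].
have [|y [_ //]] := h setT _ (ex_intro _ x (conj I Bx)).
by apply: maximal_chainT => //; exists x.
Qed.

Lemma cle_order c : maximal_chain c -> clopen_order (cle c).
Proof.
move=> mc; split.
- by move=> A B _ _; exact: cle_total (proj1 mc).
- by move=> A B C _ _ _; exact: cle_trans.
- by move=> A B _ _; exact: cle_sub.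
- by move=> A B C _ _ _; exact: cle_setU (proj1 mc).
- by move=> B _; exact: cle_set0.
- by move=> A B clA [oB _]; exact: cle_anti.
Qed.

Lemma clopenD A B : clopen A -> clopen B -> clopen (A `\` B).
Proof. by move=> clA clB; rewrite setDE; apply: clopenI => //; exact: clopenC. Qed.

Lemma separate_clopen F x : closed F -> ~ F x ->
  exists A, [/\ clopen A, A x & F `&` A = set0].
Proof.
move=> cF Fx; have : nbhs x (~` F) by apply: open_nbhs_nbhs; split=> //; exact: closed_openC.
move=> /zX [A [clA Ax AF]]; exists A; split=> //.
by rewrite -subset0 => y [Fy /AF].
Qed.

Lemma chain_of_chain R : clopen_order R -> is_chain (chain_of R).
Proof.
move=> oR; split=> [F []//|E F [[_ cE] iE] [[_ cF] iF]].
apply: contrapT => /not_orP[/existsNP[x /not_implyP[Ex Fx]] /existsNP[y /not_implyP[Fy Ey]]].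
have [A [clA Ax FA]] := separate_clopen cF Fx.
have [B [clB By EB]] := separate_clopen cE Ey.
have [h|h] := ord_total oR clA clB.
  by apply: (meets_misses (iF _ _ clA clB h _) FA); exists y.
by apply: (meets_misses (iE _ _ clB clA h _) EB); exists x.
Qed.

Lemma chain_ofE c : maximal_chain c -> chain_of (cle c) = c.
Proof.
move=> mc; apply: (proj2 mc); first exact/chain_of_chain/cle_order.
move=> F cF; split; first exact: (proj1 (proj1 mc)).
by move=> A B _ _; apply.
Qed.

(* The first member of the chain of [R] that meets the clopen set [A]. *)
Definition first_member (R : set X -> set X -> Prop) A : set X :=
  [set x | forall D, clopen D -> D x -> R D A].

(** If no point of [D] belongs to the first member, each has a clopen neighbourhood [B] with
    [~ R B A]. By [ord_setU] and compactness one such [B] contains [D], so [R D A] fails. *)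
Lemma first_memberP R A D : clopen_order R -> clopen A -> A !=set0 -> clopen D ->
  (first_member R A `&` D !=set0 <-> R D A).
Proof.
move=> oR clA A0 clD; split=> [[x [hx Dx]]|RDA]; first exact: hx.
apply: contrapT => nx; have [|||B [clB nB] DB] :=
    @clopen_directed_cover [set B | clopen B /\ ~ R B A] D _ _ _ (proj2 clD).
- by split; [split; [exact: clopen0|move=> /(ord_set0 oR clA); exact/eqP/set0P]|move=> B []].
- move=> B C [clB nB] [clC nC]; split; first exact: clopenU.
  by move=> /(ord_setU oR clB clC clA)[].
- move=> x Dx; apply: contrapT => hx; apply: nx; exists x; split=> // B clB Bx.
  by apply: contrapT => nB; apply: hx; exists B.
apply: nB; apply: (ord_trans oR clB clD clA) => //; exact: (ord_sub oR).
Qed.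

Lemma first_member_mem R A : clopen_order R -> clopen A -> A !=set0 ->
  chain_of R (first_member R A).
Proof.
move=> oR clA A0; have PA := first_memberP oR clA A0; split; first split.
- have [|x [hx _]] := (PA A clA).2; last by exists x.
  exact: (ord_sub oR clA clA).
- move=> x clx D clD Dx; apply/PA => //.
  by apply: clx; apply: open_nbhs_nbhs; split=> //; exact: (proj1 clD).
move=> B C clB clC RBC /(PA C clC) RCA; apply/(PA B clB).
exact: (ord_trans oR clB clC clA).
Qed.

Lemma cle_chain_of R A B : clopen_order R -> clopen A -> clopen B ->
  cle (chain_of R) A B <-> R A B.
Proof.
move=> oR clA clB; split=> [h|RAB F [_ hF]]; last exact: hF.
have [->|/set0P B0] := eqVneq B set0.
  by apply: (ord_sub oR) => //; exact: clopen0.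
apply/(first_memberP oR clB B0 clA); apply: h; first exact: first_member_mem.
apply/(first_memberP oR clB B0 clB); exact: (ord_sub oR clB clB).
Qed.

(** Suppose [F], in a larger chain, meets [B] but misses [A] although [R A B]. Comparison with the
    first member meeting [A] gives either a point of [A] in [F] or [R (B \ A) A], which contradicts
    [ord_anti]. *)
Lemma chain_of_maximal R : clopen_order R -> maximal_chain (chain_of R).
Proof.
move=> oR; split; first exact: chain_of_chain.
move=> d [dE dc] sd; rewrite eqEsubset; split=> // F dF.
split; first exact: dE.
move=> A B clA clB RAB [x [Fx Bx]]; apply: contrapT => FA.
have Ax : ~ A x by move=> Ax; apply: FA; exists x.
have clBA := clopenD clB clA.
have RA' : R A (B `\` A).
  apply: (ord_trans oR clA clB clBA RAB).
  by apply: (ord_sub oR) => // ? [].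
have A0 : A !=set0.
  apply/set0P/negP => /eqP A0; move: RAB; rewrite A0 => /(ord_set0 oR clB) B0.
  by rewrite B0 in Bx.
have nR : ~ R (B `\` A) A.
  by apply: ord_anti RA' => //; rewrite setDE setIC -setIA setICl setI0.
have [s|s] := dc _ _ dF (sd _ (first_member_mem oR clA A0)).
  by apply: nR; apply/(first_memberP oR clA A0 clBA); exists x; split=> //; exact: s.
apply: FA; have /(first_memberP oR clA A0 clA) : R A A.
  exact: (ord_sub oR clA clA).
exact: meets_sub.
Qed.

Lemma cle_inj c d : maximal_chain c -> maximal_chain d ->
  (forall A B, clopen A -> clopen B -> cle c A B <-> cle d A B) -> c = d.
Proof.
move=> mc md h; rewrite -(chain_ofE mc) -(chain_ofE md).
by apply/seteqP; split=> F [EF hF]; split=> // A B clA clB /(h A B clA clB); exact: hF.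
Qed.

(** * The space of maximal chains *)

Lemma exp_basis F (O : set (vietoris X)) : closed F -> nbhs (F : vietoris X) O ->
  exists W (s : seq (set X)), [/\ clopen W, F `<=` W,
    (forall A, A \in s -> clopen A /\ F `&` A !=set0) &
    forall E, E `<=` W -> (forall A, A \in s -> E `&` A !=set0) -> O E].
Proof.
move=> clF.
pose D := [set p : set X * seq (set X) | [/\ clopen p.1, F `<=` p.1 &
  forall A, A \in p.2 -> clopen A /\ F `&` A !=set0]].
pose B (p : set X * seq (set X)) : set (vietoris X) :=
  [set E | (E : set X) `<=` p.1 /\ forall A, A \in p.2 -> (E : set X) `&` A !=set0].
have FF : Filter (filter_from D B).
  apply: filter_from_filter; first by exists (setT, [::]); split=> //=; exact: clopenT.
  move=> [W s] [V t] [/= clW FW hs] [/= clV FV ht]; exists (W `&` V, s ++ t).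
    split=> /=; [exact: clopenI|by rewrite subsetI|].
    by move=> A; rewrite mem_cat => /orP[/hs|/ht].
  move=> E [/= EW hE]; split; split=> /=.
  - by move=> x /EW [].
  - by move=> A As; apply: hE; rewrite mem_cat As.
  - by move=> x /EW [].
  - by move=> A As; apply: hE; rewrite mem_cat As orbT.
move=> nO; suff [[W s] [/= clW FW hs] BO] : filter_from D B O.
  by exists W, s; split=> // E EW hE; apply: BO.
move: O nO; apply: vietoris_cvg => O oO.
  move=> /(clopen_between clF oO)[W [clW FW WO]].
  by exists (W, [::]) => //= E [/= EW _]; exact: subset_trans WO.
move=> [x [Fx Ox]]; have /zX[A [clA Ax AO]] : nbhs x O by exact: open_nbhs_nbhs.
exists (setT, [:: A]); first split=> //=; first exact: clopenT.
  by move=> C; rewrite inE => /eqP->; split=> //; exists x.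
by move=> E [_ /= hE]; apply: meets_sub AO (hE A (mem_head _ _)).
Qed.

(* The limit, along an ultrafilter, of a family of closed sets. *)
Definition exp_lim (I : Type) (U : set_system I) (E : I -> set X) : set X :=
  [set x | forall D, clopen D -> D x -> U [set i | E i `&` D !=set0]].

Lemma exp_lim_closed I U (E : I -> set X) : closed (exp_lim U E).
Proof.
move=> x clx D clD Dx.
have [|y [hy Dy]] := clx D; first by apply: open_nbhs_nbhs; split=> //; case: clD.
exact: hy.
Qed.

Lemma exp_lim_meets I U (E : I -> set X) K : UltraFilter U -> closed K ->
  U [set i | E i `&` K !=set0] -> exp_lim U E `&` K !=set0.
Proof.
move=> UU cK UK; apply: contrapT => nL.
have [||||W [clW UW] KW] :=
   @clopen_directed_cover [set D | clopen D /\ U [set i | E i `&` D = set0]] K.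
- split=> [|B []//]; split; first exact: clopen0.
  by apply: filterE => i; rewrite /= setI0.
- move=> B C [clB UB] [clC UC]; split; first exact: clopenU.
  by apply: filterS2 UB UC => i /= e1 e2; rewrite setIUr e1 e2 setU0.
- move=> x Kx; apply: contrapT => hx; apply: nL; exists x; split=> // D clD Dx.
  have [//|UD] := in_ultra_setVsetC [set i | E i `&` D !=set0] UU.
  by case: hx; exists D => //; split=> //; apply: filterS UD => i /= /set0P/negP/negPn/eqP.
- by [].
have [i [/= [x [Ex Kx]] e]] := filter_ex (filterI UK UW).
by have : (E i `&` W) x; [split=> //; exact: KW|rewrite e].
Qed.

Lemma exp_lim_cvg I U (E : I -> set X) : UltraFilter U ->
  (E : I -> vietoris X) i @[i --> U] --> (exp_lim U E : vietoris X).
Proof.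
move=> UU; apply: vietoris_cvg => O oO h /=.
  have [UO|UO] := in_ultra_setVsetC [set i | E i `<=` O] UU; first exact: UO.
  suff [x [Lx nOx]] : exp_lim U E `&` ~` O !=set0 by case: (nOx (h _ Lx)).
  apply: exp_lim_meets; first exact: open_closedC.
  by apply: filterS UO => i /= /existsNP[x /not_implyP[Ex Ox]]; exists x.
case: h => x [Lx Ox]; have /zX[A [clA Ax AO]] : nbhs x O by exact: open_nbhs_nbhs.
by apply: filterS (Lx A clA Ax) => i; apply: meets_sub.
Qed.

(** Reduces Vietoris convergence of chains to convergence of their orders on clopen sets. The two
    halves treat the two kinds of subbasic sets. *)
Lemma phi_cvg_ultra (U : set_system (Exp2 X)) (c : Exp2 X) : UltraFilter U ->
  U (@Phi X) -> Phi c ->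
  (forall A B, clopen A -> clopen B -> cle c A B -> U [set d : Exp2 X | cle d A B]) ->
  (forall A B, clopen A -> clopen B -> ~ cle c A B -> U [set d : Exp2 X | ~ cle d A B]) ->
  U --> c.
Proof.
move=> UU Uphi pc h1 h2; have [[cE cc] mc] := pc.
have nbO (O : set (vietoris X)) F : @ExpS X F -> open (O : set (subspace (@ExpS X))) -> O F ->
    exists2 V, nbhs (F : vietoris X) V & forall E, @ExpS X E -> V E -> O E.
  move=> EF oO OF; have VO : within (@ExpS X) (nbhs (F : vietoris X)) O.
    by rewrite nbhs_subspace_in //; apply: (@open_nbhs_nbhs (subspace (@ExpS X))).
  by exists [set E | @ExpS X E -> O E] => // E EE; apply.
apply: vietoris_cvg => O oO.
  move=> cO; have [UO|UO] := in_ultra_setVsetC [set d : Exp2 X | (d : set (set X)) `<=` O] UU.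
    exact: UO.
  have /choice[E hE] : forall d : Exp2 X, exists E : set X,
     ~ ((d : set (set X)) `<=` O) -> (d : set (set X)) E /\ ~ O E.
    move=> d; have [dO|/existsNP[F /not_implyP[? ?]]] := pselect ((d : set (set X)) `<=` O).
      by exists set0.
    by exists F.
  have UE : U [set d | [/\ Phi d, (d : set (set X)) (E d) & ~ O (E d)]].
    by apply: filterS2 Uphi UO => d pd /hE [].
  (* Limits of members respect [cle c], since each of its relations holds for most [d]; hence they
     are members of [c] and lie in [O]. *)
  have Lc : c (exp_lim U E : set X).
    rewrite -(chain_ofE pc); split; first split.
    - suff [x [Lx _]] : exp_lim U E `&` setT !=set0 by exists x.
      apply: exp_lim_meets; first exact: closedT.
      by apply: filterS UE => d [[[dE _] _] /dE[[x Ex] _] _]; exists x.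
    - exact: exp_lim_closed.
    move=> A B clA clB /(h1 A B clA clB) UAB [x [Lx Bx]].
    apply: exp_lim_meets; first by case: clA.
    by apply: filterS2 (filterI UE UAB) (Lx B clB Bx) => d [[_ dEd _] hd]; exact: hd.
  have [V nV hV] := nbO O _ (cE _ Lc) oO (cO _ Lc).
  have UV : U [set d | V (E d)] := @exp_lim_cvg _ _ E UU V nV.
  have [d [[[[dE _] _] dEd nO] /= VE]] := filter_ex (filterI UE UV).
  by case: nO; apply: hV => //; exact: dE.
move=> [F [cF OF]]; have [V nV hV] := nbO O F (cE _ cF) oO OF.
have [W [s [clW FW hs hWs]]] := exp_basis (proj2 (cE _ cF)) nV.
have clB := clopenC setT clW.
have UA A : F `&` A !=set0 -> clopen A -> U [set d : Exp2 X | ~ cle d (~` W) A].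
  move=> FA clA; apply: h2 => // h.
  by have [x [Fx /(_ (FW _ Fx))]] := h F cF FA.
have [F0 _] := cE _ cF.
have FT : F `&` setT !=set0 by case: F0 => x Fx; exists x.
have UT := UA setT FT clopenT.
(* For each [A] in [s], most [d] have a member inside [W] that meets [A]. The largest of these
   finitely many members meets all of them. *)
suff : U [set d : Exp2 X | exists E, [/\ (d : set (set X)) E, E !=set0, E `&` ~` W = set0 &
    forall A, A \in s -> E `&` A !=set0]].
  apply: filterS2 Uphi => d [[dE _] _] [E [dE' E0 EW Es]]; exists E; split=> //.
  apply: hV; first exact: dE.
  by apply: hWs Es; rewrite -setD_eq0 setDE.
elim: s hs {hWs} => [|A s IH] hs.
  apply: filterS UT => d /not_cle[E [dE' [x [Ex _]] EW]].
  by exists E; split=> //; exists x.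
have [clA FA] := hs A (mem_head _ _).
have IHs := IH (fun C Cs => hs C (mem_behead (s := A :: s) Cs)).
apply: filterS2 (filterI Uphi (UA A FA clA)) IHs => d [pd /not_cle[E1 [d1 E1A E1W]]].
move=> [E2 [d2 E20 E2W E2s]]; have [[_ dc] _] := pd.
have [s12|s21] := dc _ _ d1 d2.
  exists E2; split=> // C; rewrite inE => /orP[/eqP->|/E2s //].
  exact: meets_sub s12 _ E1A.
exists E1; split=> //; first by case: E1A => x [Ex _]; exists x.
move=> C; rewrite inE => /orP[/eqP->//|/E2s]; exact: meets_sub.
Qed.

Lemma phi_cvg (F : set_system (Exp2 X)) (c : Exp2 X) : Filter F ->
  F (@Phi X) -> Phi c ->
  (forall A B, clopen A -> clopen B -> F [set d : Exp2 X | cle d A B <-> cle c A B]) ->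
  F --> c.
Proof.
move=> FF Fphi pc h W nW; apply: contrapT => nF.
pose G := within (~` W) F.
have GG : ProperFilter G.
  split; last exact: within_filter.
  by rewrite /G /within /= => n0; apply: nF; apply: filterS n0 => d /= /contrapT.
have [U [UU GU]] := ultraFilterLemma GG.
have FU (A : set (Exp2 X)) : F A -> U A by move=> FA; apply: GU; apply: filterS FA => d /=.
have UW : U (~` W) by apply: GU; exact: withinT.
have Uc : U --> c.
  apply: phi_cvg_ultra => //; first exact: FU.
    by move=> A B clA clB cAB; apply: filterS (FU _ (h A B clA clB)) => d [_]; apply.
  by move=> A B clA clB cAB; apply: filterS (FU _ (h A B clA clB)) => d e /e.
by have [x []] := filter_ex (filterI UW (Uc W nW)).
Qed.

(** Along an ultrafilter the relations that hold for most chains form a [clopen_order], and its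
    chain is the limit. *)
Lemma compact_phi : compact (@Phi X).
Proof.
rewrite compact_ultra => U UU Uphi.
pose R A B := U [set c : Exp2 X | cle c A B].
have UP (P : Prop) : U [set c : Exp2 X | P] -> P by move=> /filter_ex[].
have UV (P Q : set (Exp2 X)) : (forall c, Phi c -> P c \/ Q c) -> U P \/ U Q.
  move=> PQ; have [|nP] := in_ultra_setVsetC P UU; [by left|right].
  by apply: filterS2 Uphi nP => c /PQ[].
have oR : clopen_order R.
  split; rewrite /R.
  - by move=> A B clA clB; apply: UV => c [+ _]; exact: cle_total.
  - by move=> A B C clA clB clC h1 h2; apply: filterS2 h1 h2 => c; exact: cle_trans.
  - by move=> A B clA clB AB; apply: filterE => c; exact: cle_sub.
  - move=> A B C clA clB clC RC; have [|h|h] := UV [set c | cle c (A `|` B) C -> cle c A C]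
      [set c | cle c (A `|` B) C -> cle c B C].
    + move=> c [/cle_setU h _]; have [/h []|n] := pselect (cle c (A `|` B) C);
        [by left|by right|by left].
    + by left; apply: filterS2 h RC => c /=.
    + by right; apply: filterS2 h RC => c /=.
  - move=> B clB RB; apply: UP; apply: filterS2 Uphi RB => c; exact: cle_set0.
  - move=> A B clA clB AB A0 RAB RBA; apply: (UP False).
    apply: filterS2 Uphi (filterI RAB RBA) => c pc [h1 h2].
    by apply: cle_anti h1 h2 => //; case: clB.
exists (chain_of R : Exp2 X); split; first exact: chain_of_maximal.
apply: phi_cvg_ultra => //; first exact: chain_of_maximal.
  by move=> A B clA clB /(cle_chain_of oR clA clB).
move=> A B clA clB /(cle_chain_of oR clA clB) nR.
by have [//|] := in_ultra_setVsetC [set c : Exp2 X | cle c A B] UU.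
Qed.

Lemma not_cle_near (c : Exp2 X) A B : is_chain c -> clopen A -> clopen B -> ~ cle c A B ->
  \forall d \near c, ~ cle d A B.
Proof.
move=> cc [oA clA] [oB clB] /not_cle[F [cF FB FA]].
pose O : set (vietoris X) := [set E | (E : set X) `<=` ~` A] `&` [set E | (E : set X) `&` B !=set0].
have oO : open (O : set (subspace (@ExpS X))).
  apply: open_subspaceW; apply: openI; first exact/open_vietoris_subset/closed_openC.
  exact: open_vietoris_meets.
have nO : nbhs c [set d : Exp2 X | (d : set (subspace (@ExpS X))) `&` O !=set0].
  apply: open_nbhs_nbhs; split; first exact: open_vietoris_meets.
  by exists F; split=> //; split=> // x Fx Ax; have : (F `&` A) x by []; rewrite FA.
apply: filterS nO => d [E [dE [/= EA EB]]] /(_ E dE EB)[x [/EA]].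
by [].
Qed.

(** Failure of [cle] is an open condition. For nonempty [A] and [B] not inside [A], [cle c A B] is
    itself the failure of [cle c (B \ A) A], by totality and antisymmetry. *)
Lemma cle_near (c : Exp2 X) A B : Phi c -> clopen A -> clopen B ->
  within (@Phi X) (nbhs c) [set d : Exp2 X | cle d A B <-> cle c A B].
Proof.
move=> pc clA clB; have [cAB|nAB] := pselect (cle c A B); last first.
  by apply: filterS (not_cle_near (proj1 pc) clA clB nAB) => d /= h _; split=> [/h|/nAB].
have clBA := clopenD clB clA.
have [BA0|/set0P BA0] := eqVneq (B `\` A) set0.
  by apply: filterE => d; split=> _ //; apply: cle_sub; rewrite -setD_eq0.
have A0 : A !=set0.
  apply/set0P/negP => /eqP A0; move: cAB BA0; rewrite A0 setD0 => /(cle_set0 pc) -> [].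
  by [].
have cABA : cle c A (B `\` A) by apply: cle_trans cAB _; apply: cle_sub => ? [].
have nBA : ~ cle c (B `\` A) A.
  apply: cle_anti cABA => //; first by case: clBA.
  by rewrite setDE setIC -setIA setICl setI0.
apply: filterS (not_cle_near (proj1 pc) clBA clA nBA) => d /= h pd; split=> // _ F dF [x [Fx Bx]].
have [Ax|Ax] := pselect (A x); first by exists x.
have [dA|/h//] := cle_total A (B `\` A) (proj1 pd).
by apply: dA => //; exists x.
Qed.

Lemma hausdorff_phi : hausdorff_space (set_type (@Phi X)).
Proof.
move=> p q cl; apply: val_inj; apply: cle_inj; [exact: set_mem (valP p)|exact: set_mem (valP q)|].
move=> A B clA clB.
have near_val (r : set_type (@Phi X)) : nbhs r
    [set d : set_type (@Phi X) | cle (\val d) A B <-> cle (\val r) A B].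
  have := cle_near (set_mem (valP r)) clA clB; rewrite /within /= => n.
  have m := @initial_continuous _ _ (set_val : set_type (@Phi X) -> Exp2 X) r _ n.
  have {}m : nbhs r (fun d : set_type (@Phi X) =>
    Phi (sval d) -> cle (sval d) A B <-> cle (sval r) A B) := m.
  apply: filterS m => d /=; apply; exact: set_mem (valP d).
by have [d [/= <- <-]] := cl _ _ (near_val p) (near_val q).
Qed.

(** * Clopen partitions ordered by a chain *)

Hypothesis hh : h_homogeneous X.
Variable x0 : X.
Implicit Types p q : X -> nat.

(** A partition is coded by its labelling function, so that coarsening is composition on the left
    and the action of a homeomorphism is composition on the right. *)
Definition lpart n p := [/\ forall i, clopen (p @^-1` [set i]), forall x, p x < n &
  forall i, i < n -> exists x, p x = i].

(* The chain [c] meets the pieces of [p] in the order of their labels. *)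
Definition csorted c n p := forall i j, i < j < n ->
  ~ cle c (p @^-1` [set j]) (p @^-1` [set i]).

Lemma clopen_bigU (T : finType) (S : {pred T}) (f : T -> set X) :
  (forall t, clopen (f t)) -> clopen [set x | exists2 t, t \in S & f t x].
Proof.
move=> cf; split.
  have -> : [set x | exists2 t, t \in S & f t x] = \bigcup_(t in [set` S]) f t.
    by apply/seteqP; split=> x [t tS ftx]; exists t.
  by apply: bigcup_open => t _; case: (cf t).
have -> : [set x | exists2 t, t \in S & f t x] = \bigcup_(t in [set` S]) f t.
  by apply/seteqP; split=> x [t tS ftx]; exists t.
by apply: closed_bigcup => // t _; case: (cf t).
Qed.

Lemma clopen_preimage_fin (T : finType) (p : X -> T) (S : set T) :
  (forall t, clopen (p @^-1` [set t])) -> clopen (p @^-1` S).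
Proof.
move=> cp; rewrite (_ : p @^-1` S = [set x | exists2 t, t \in [pred t | `[< S t >]] &
  (p @^-1` [set t]) x]); first exact: clopen_bigU.
apply/seteqP; split=> x /=.
  by move=> Spx; exists (p x) => //; exact/asboolP.
by move=> [t /asboolP St ->].
Qed.

Lemma lpart_preimage n p S : lpart n p -> clopen (p @^-1` S).
Proof.
move=> [cp pn _].
pose p' x : 'I_n := Ordinal (pn x).
have -> : p @^-1` S = p' @^-1` [set i | S (val i)] by [].
apply: clopen_preimage_fin => t.
rewrite (_ : p' @^-1` [set t] = p @^-1` [set val t]) //.
by apply/seteqP; split=> x /= e; [rewrite -e|exact: val_inj].
Qed.

(** The nonempty fibres of [f] are sorted by [cle c], and [q] gives the position in the sorted list;
    [cle_anti] makes the order strict. *)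
Lemma refine_sorted c (T : finType) (f : X -> T) : maximal_chain c ->
  (forall t, clopen (f @^-1` [set t])) ->
  exists n q (s : nat -> T) (t : T -> nat),
    [/\ lpart n q, csorted c n q, f = s \o q & q = t \o f].
Proof.
move=> mc cf; pose fib t := f @^-1` [set t].
pose le t u := `[< cle c (fib t) (fib u) >].
have le_total : total le.
  by move=> t u; rewrite /le; apply/orP;
    case: (cle_total (fib t) (fib u) (proj1 mc)) => h; [left|right]; apply/asboolP.
have le_trans : transitive le.
  by move=> u t v /asboolP h1 /asboolP h2; apply/asboolP; exact: cle_trans h1 h2.
pose im := [seq t <- enum T | `[< fib t !=set0 >]].
pose L := sort le im.
have uL : uniq L by rewrite sort_uniq filter_uniq // enum_uniq.
have mL t : (t \in L) = `[< fib t !=set0 >].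
  by rewrite mem_sort mem_filter mem_enum andbT.
have fL x : f x \in L by rewrite mL; apply/asboolP; exists x.
have qfib i : i < size L -> (fun x => index (f x) L) @^-1` [set i] = fib (nth (f x0) L i).
  move=> iL; apply/seteqP; split=> x /=.
    by move=> <-; rewrite /fib /= nth_index.
  by rewrite /fib /= => ->; rewrite index_uniq.
exists (size L), (fun x => index (f x) L), (nth (f x0) L), (fun t => index t L); split.
- split=> [i|x|i iL].
  + have [iL|Li] := ltnP i (size L); first by rewrite qfib //; exact: cf.
    have -> : (fun x => index (f x) L) @^-1` [set i] = set0; last exact: clopen0.
    rewrite -subset0 => x /= e; move: Li; rewrite -e leqNgt index_mem fL //.
  + by rewrite index_mem fL.
  + have := mem_nth (f x0) iL; rewrite mL => /asboolP[x fx].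
    by exists x; rewrite -[RHS](index_uniq (f x0) iL uL) -fx.
- move=> i j /andP[ij jL]; have iL := ltn_trans ij jL.
  rewrite !qfib //; apply: cle_anti => //; [exact: cf|by case: (cf (nth (f x0) L j))| | |].
  + rewrite -subset0 => x [/= e1 e2]; move: ij.
    by rewrite -[i](index_uniq (f x0) iL uL) -e1 e2 index_uniq // ltnn.
  + by have := mem_nth (f x0) iL; rewrite mL => /asboolP.
  + have := sorted_ltn_nth le_trans (f x0) (sort_sorted le_total im) => /(_ i j iL jL ij).
    by move/asboolP.
- by apply/funext => x /=; rewrite nth_index.
- by [].
Qed.

Lemma csorted_not_cle c n p i : maximal_chain c -> lpart n p -> csorted c n p ->
  ~ cle c (p @^-1` [set j | i < j]) (p @^-1` [set i]) \/ p @^-1` [set i] = set0.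
Proof.
move=> mc [cp pn pm] sp; have [iN|Ni] := ltnP i n; last first.
  by right; rewrite -subset0 => x /= e; have := pn x; rewrite e ltnNge Ni.
left.
have -> : [set j | i < j] = [set j | i < j < n] `|` [set j | i < j /\ n <= j].
  apply/seteqP; split=> j /=; last by case=> [/andP[]|[]].
  by move=> ij; case: (ltnP j n) => h; [left; apply/andP|right].
rewrite preimage_setU (_ : p @^-1` [set j | i < j /\ n <= j] = set0) ?setU0; last first.
  by rewrite -subset0 => x /= [_]; rewrite leqNgt pn.
have : n <= n by []; elim: {1 3}n => [_|k IH kn].
  rewrite (_ : p @^-1` _ = set0).
    by have [x px] := pm i iN => /(cle_set0 mc)/seteqP[/(_ x px)].
  by rewrite -subset0 => x /= /andP[].
have -> : p @^-1` [set j | i < j < k.+1] = p @^-1` [set j | i < j < k] `|`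
    p @^-1` [set j | i < j /\ j = k].
  apply/seteqP; split=> x /=.
    by rewrite ltnS (leq_eqVlt (p x)) => /andP[h /orP[/eqP|h']]; [right|left; apply/andP].
  by case=> [/andP[h h']|[h h']]; rewrite h ltnS /=; [exact: ltnW|rewrite h'].
move=> /(cle_setU (proj1 mc))[|]; first exact: IH (ltnW kn).
have [ik|ki] := ltnP i k.
  rewrite (_ : p @^-1` [set j | i < j /\ j = k] = p @^-1` [set k]); first by apply: sp; rewrite ik.
  by apply/seteqP; split=> x /=; [case|move=> ->].
rewrite (_ : p @^-1` _ = set0); first by have [x px] := pm i iN => /(cle_set0 mc)/seteqP[/(_ x px)].
by rewrite -subset0 => x /= [h e]; move: ki; rewrite -e leqNgt h.
Qed.

(** A sorted partition determines [cle c] on all unions of its pieces, since a union is met when its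
    piece of least label is. *)
Lemma csorted_cle c n p (I J : set nat) : maximal_chain c -> lpart n p -> csorted c n p ->
  cle c (p @^-1` I) (p @^-1` J) <->
  (forall j, J j -> j < n -> exists2 i, I i & i <= j).
Proof.
move=> mc lp sp; have [cp pn pm] := lp; split=> h.
  move=> j Jj jn; apply: contrapT => nI.
  have [|p0] := csorted_not_cle j mc lp sp; last first.
    by have [x px] := pm j jn; move/seteqP: p0 => [/(_ x px)].
  apply; apply: cle_trans (_ : cle c (p @^-1` I) _).
    apply: cle_sub => x /= Ipx; rewrite ltnNge; apply/negP => pj.
    by apply: nI; exists (p x).
  by apply: cle_trans h _; apply: cle_sub => x /= ->.
move=> F cF [x [Fx /= Jpx]]; have [i Ii ij] := h _ Jpx (pn x).
suff [y [Fy py]] : F `&` p @^-1` [set i] !=set0 by exists y; split=> //=; rewrite py.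
move: ij; rewrite leq_eqVlt => /orP[/eqP->|ij]; first by exists x.
have nc := sp i (p x) _; rewrite ij pn in nc.
have [h'|/(nc isT)//] := cle_total (p @^-1` [set i]) (p @^-1` [set p x]) (proj1 mc).
by apply: h' cF _; exists x.
Qed.

Lemma csorted_coarsen c d n p m q (s : nat -> nat) : maximal_chain c -> maximal_chain d ->
  lpart n p -> csorted c n p -> csorted d n p ->
  q = s \o p -> csorted c m q -> csorted d m q.
Proof.
move=> mc md lp scp sdp -> scq i j ijm; have := scq i j ijm.
have e k : (s \o p) @^-1` [set k] = p @^-1` (s @^-1` [set k]) by [].
rewrite !e; apply: contra_not.
by move/(csorted_cle _ _ md lp sdp)/(csorted_cle _ _ mc lp scp).
Qed.

Lemma csorted_near n p (c : Exp2 X) : Phi c -> lpart n p -> csorted c n p ->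
  within (@Phi X) (nbhs c) [set d : Exp2 X | csorted d n p].
Proof.
move=> pc [cp _ _] sc.
suff h : \forall d \near within (@Phi X) (nbhs c), forall i j : 'I_n, i < j ->
    ~ cle d (p @^-1` [set val j]) (p @^-1` [set val i]).
  apply: filterS h => d h i j /andP[ij jn].
  exact: (h (Ordinal (ltn_trans ij jn)) (Ordinal jn)).
apply: filter_forall => i; apply: filter_forall => j.
have := cle_near pc (cp j) (cp i); apply: filterS => d e ij /e.
by apply: sc; rewrite ij ltn_ord.
Qed.

Lemma join_sorted c n1 p1 n2 p2 : maximal_chain c -> lpart n1 p1 -> lpart n2 p2 ->
  exists n q (s t : nat -> nat),
    [/\ lpart n q, csorted c n q, p1 = s \o q & p2 = t \o q].
Proof.
move=> mc [l1 b1 _] [l2 b2 _].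
pose f x : 'I_n1 * 'I_n2 := (Ordinal (b1 x), Ordinal (b2 x)).
have [|n [q [s [_ [lq sq fs _]]]]] := @refine_sorted c _ f mc.
  move=> [i j]; rewrite (_ : f @^-1` _ = p1 @^-1` [set val i] `&` p2 @^-1` [set val j]).
    exact: clopenI.
  apply/seteqP; split=> x /=; first by case=> <- <-.
  by case=> e1 e2; congr pair; apply: val_inj.
exists n, q, (fun i => val (s i).1), (fun i => val (s i).2); split=> //; apply/funext => x.
  by have := congr1 (fun g => val (g x).1) fs.
by have := congr1 (fun g => val (g x).2) fs.
Qed.

Lemma clopen_sorted c A : maximal_chain c -> clopen A ->
  exists n q (S : set nat), [/\ lpart n q, csorted c n q & A = q @^-1` S].
Proof.
move=> mc clA; have [|n [q [s [_ [lq sq fs _]]]]] := @refine_sorted c bool (fun x => x \in A) mc.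
  case.
    rewrite (_ : _ @^-1` _ = A) //.
    by apply/seteqP; split=> x /=; [exact: set_mem|exact: mem_set].
  rewrite (_ : _ @^-1` _ = ~` A); first exact: clopenC.
  apply/seteqP; split=> x /= => [/negbT|h]; first by rewrite notin_setE.
  by apply/negbTE; rewrite notin_setE.
exists n, q, [set i | s i]; split=> //.
by apply/seteqP; split=> x /=; rewrite -[s (q x)]/((s \o q) x) -fs inE.
Qed.

(** Any two clopen sets are unions of pieces of one sorted partition, which then decides their
    order; common refinements make these sets a filter base, and [phi_cvg] applies. *)
Lemma phi_base (c : Exp2 X) (W : set (Exp2 X)) : Phi c -> nbhs c W ->
  exists n p, [/\ lpart n p, csorted c n p &
    forall d : Exp2 X, Phi d -> csorted d n p -> W d].
Proof.
move=> pc nW.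
pose D := [set np : nat * (X -> nat) | lpart np.1 np.2 /\ csorted c np.1 np.2].
pose B (np : nat * (X -> nat)) := [set d : Exp2 X | Phi d /\ csorted d np.1 np.2].
have FF : Filter (filter_from D B).
  apply: filter_from_filter.
    by have [n [q [_ [lq sq _]]]] := clopen_sorted pc clopenT; exists (n, q).
  move=> [n1 p1] [n2 p2] [/= lp1 sp1] [/= lp2 sp2].
  have [n [q [s [t [lq sq e1 e2]]]]] := join_sorted pc lp1 lp2.
  exists (n, q) => // d [/= pd sd]; split; split=> //=.
    exact: csorted_coarsen pc pd lq sq sd e1 sp1.
  exact: csorted_coarsen pc pd lq sq sd e2 sp2.
have cvB : filter_from D B --> c.
  apply: phi_cvg => //.
    by have [np Dnp _] := @filterT _ _ FF; exists np => // d [].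
  move=> A1 A2 cl1 cl2.
  have [n1 [q1 [S1 [lq1 _ ->]]]] := clopen_sorted pc cl1.
  have [n2 [q2 [S2 [lq2 _ ->]]]] := clopen_sorted pc cl2.
  have [n [q [s [t [lq sq -> ->]]]]] := join_sorted pc lq1 lq2.
  exists (n, q) => // d [/= pd sd].
  apply: (iff_trans (csorted_cle (s @^-1` S1) (t @^-1` S2) pd lq sd)).
  exact: iff_sym (csorted_cle _ _ pc lq sq).
have [[n p] [/= lp sp] BW] := cvB W nW; exists n, p; split=> // d pd sd; exact: BW.
Qed.

Lemma lpart_size n m p q (s t : nat -> nat) : lpart n p -> lpart m q ->
  p = s \o q -> q = t \o p -> n = m.
Proof.
wlog suff h : n m p q s t / lpart n p -> lpart m q -> p = s \o q -> n <= m.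
  by move=> lp lq e1 e2; apply/eqP; rewrite eqn_leq (h n m p q s t) //= (h m n q p t s).
move=> [_ pn pm] [_ qn qm] e.
suff : {subset iota 0 n <= map s (iota 0 m)}.
  by move/(uniq_leq_size (iota_uniq _ _)); rewrite size_map !size_iota.
move=> i; rewrite mem_iota /= => /pm[x <-]; rewrite e /=; apply: map_f.
by rewrite mem_iota /= qn.
Qed.

Lemma csorted_relabel c n p : maximal_chain c -> lpart n p ->
  exists q (s t : nat -> nat), [/\ lpart n q, csorted c n q, p = s \o q & q = t \o p].
Proof.
move=> mc lp; have [cp pn pm] := lp.
pose f x : 'I_n := Ordinal (pn x).
have [|m [q [s [t [lq sq fs qt]]]]] := refine_sorted mc (f := f).
  move=> i; rewrite (_ : f @^-1` _ = p @^-1` [set val i]) //.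
  by apply/seteqP; split=> x /= e; [rewrite -e|exact: val_inj].
have e1 : p = (fun i => val (s i)) \o q.
  by apply/funext => x; have := congr1 (fun g => val (g x)) fs.
have e2 : q = (fun i => if insub i is Some j then t j else 0) \o p.
  apply/funext => x; rewrite [in LHS]qt /=.
  by case: insubP => [j _ e|]; [congr t; apply: val_inj|rewrite pn].
have nm := lpart_size lp lq e1 e2; subst m.
by exists q, (fun i => val (s i)), (fun i => if insub i is Some j then t j else 0).
Qed.

(** * Transitivity of homeomorphisms on labelled partitions *)

Lemma glue_continuous n q (F : nat -> X -> X) : lpart n q ->
  (forall i, i < n -> {within q @^-1` [set i], continuous (F i)}) ->
  continuous (fun x => F (q x) x).
Proof.
move=> [cq qn qm] cF x; have [oq _] := cq (q x).
have := cF _ (qn x); rewrite continuous_open_subspace // => /(_ x).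
rewrite inE => /(_ erefl) cx.
have e : \forall y \near x, F (q x) y = F (q y) y.
  have : nbhs x (q @^-1` [set q x]) by exact: open_nbhs_nbhs.
  by apply: filterS => y /= ->.
by move=> W /= nW; apply: (@filterS2 _ (nbhs x) _ _ _ _ _ e (cx W nW)) => y /= ->.
Qed.

(** By h-homogeneity the pieces labelled [i] of [q] and of [p] are both homeomorphic to [X]; the
    maps from one to the other through [X] are glued. *)
Lemma lpart_transitive n p q : lpart n p -> lpart n q ->
  exists2 g : X -> X, homeo g & p \o g = q.
Proof.
have H r : lpart n r -> exists fg : nat -> (X -> X) * (X -> X), forall i, i < n ->
   [/\ {within r @^-1` [set i], continuous (fg i).1}, continuous (fg i).2,
    (forall x, r x = i -> (fg i).2 ((fg i).1 x) = x) &
    (forall y, r ((fg i).2 y) = i /\ (fg i).1 ((fg i).2 y) = y)].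
  move=> [cr rn rm].
  suff /choice[fg h] : forall i, exists fg : (X -> X) * (X -> X), i < n ->
   [/\ {within r @^-1` [set i], continuous fg.1}, continuous fg.2,
    (forall x, r x = i -> fg.2 (fg.1 x) = x) &
    (forall y, r (fg.2 y) = i /\ fg.1 (fg.2 y) = y)] by exists fg.
  move=> i; have [iN|_] := ltnP i n; last by exists (id, id).
  have [|f [g [h1 h2 h3 h4]]] := hh (cr i) _; first by have [x rx] := rm i iN; exists x.
  by exists (f, g).
move=> lp lq; have [fp hp] := H p lp; have [fq hq] := H q lq.
have qn := let: And3 _ h _ := lq in h; have pn := let: And3 _ h _ := lp in h.
have comp s (fr fs : nat -> (X -> X) * (X -> X)) : lpart n s ->
   (forall i, i < n -> continuous (fr i).2) ->
   (forall i, i < n -> {within s @^-1` [set i], continuous (fs i).1}) ->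
   continuous (fun x => (fr (s x)).2 ((fs (s x)).1 x)).
  move=> ls cr cs; apply: (@glue_continuous n s (fun i x => (fr i).2 ((fs i).1 x)) ls) => i iN.
  have os : open (s @^-1` [set i]) by case: ls => /(_ i)[].
  have := cs i iN; rewrite !continuous_open_subspace // => c1 x xi.
  by apply: (continuous_comp (c1 x xi)); exact: cr.
exists (fun x => (fp (q x)).2 ((fq (q x)).1 x)); last first.
  by apply/funext => x /=; have [_ _ _ /(_ ((fq (q x)).1 x))[]] := hp _ (qn x).
split; first by apply: (comp q) => // i iN; [case: (hp i iN)|case: (hq i iN)].
exists (fun x => (fq (p x)).2 ((fp (p x)).1 x)); split.
- by apply: (comp p) => // i iN; [case: (hq i iN)|case: (hp i iN)].
- move=> x; have [_ _ _ /(_ ((fq (q x)).1 x))[e1 e2]] := hp _ (qn x).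
  by rewrite e1 e2; have [_ _ ->] := hq _ (qn x).
- move=> x; have [_ _ _ /(_ ((fp (p x)).1 x))[e1 e2]] := hq _ (pn x).
  by rewrite e1 e2; have [_ _ ->] := hp _ (pn x).
Qed.

(** * The action on maximal chains *)

Lemma homeo_id : homeo (@idfun X).
Proof. by split; [move=> x|exists idfun; split=> // x]. Qed.

Lemma homeo_comp (g h : X -> X) : homeo g -> homeo h -> homeo (g \o h).
Proof.
move=> [cg [g' [cg' gK g'K]]] [ch [h' [ch' hK h'K]]]; split.
  by move=> x; apply: continuous_comp; [exact: ch|exact: cg].
exists (h' \o g'); split.
- by move=> x; apply: continuous_comp; [exact: cg'|exact: ch'].
- by move=> x /=; rewrite gK hK.
- by move=> x /=; rewrite h'K g'K.
Qed.

Lemma homeo_inv (g : X -> X) : homeo g ->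
  exists h : X -> X, [/\ homeo h, cancel g h & cancel h g].
Proof.
move=> [cg [h [ch gK hK]]]; exists h; split=> //; split=> //.
by exists g.
Qed.

Lemma preimage_homeo (g : X -> X) A : homeo g -> clopen A -> clopen (g @^-1` A).
Proof. by move=> [cg _] clA; exact: preimage_clopen. Qed.

Lemma image_meets (g : X -> X) F A : (g @` F) `&` A !=set0 <-> F `&` g @^-1` A !=set0.
Proof.
split=> [[_ [[x Fx <-] Ax]]|[x [Fx Ax]]]; first by exists x.
by exists (g x); split=> //; exists x.
Qed.

Lemma cle_act (g : X -> X) (c : Exp2 X) A B :
  cle (phi_act g c) A B <-> cle c (g @^-1` A) (g @^-1` B).
Proof.
split=> h F.
  move=> cF /image_meets FB; apply/image_meets; apply: h FB; by exists F.
move=> [E cE <-] /image_meets EB; apply/image_meets; exact: h EB.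
Qed.

Lemma csorted_act (g : X -> X) (c : Exp2 X) n p :
  csorted (phi_act g c) n p <-> csorted c n (p \o g).
Proof.
by split=> h i j /h; apply: contra_not;
  have [] := cle_act g c (p @^-1` [set j]) (p @^-1` [set i]).
Qed.

Lemma image_cancel (g h : X -> X) F : cancel g h -> h @` (g @` F) = F.
Proof.
move=> gK; apply/seteqP; split=> [_ [_ [x Fx <-] <-]|x Fx]; first by rewrite gK.
by exists (g x); [exists x|rewrite gK].
Qed.

Lemma ExpS_image (g : X -> X) F : homeo g -> @ExpS X F -> @ExpS X (g @` F).
Proof.
move=> /homeo_inv[h [[ch _] gK hK]] [[x Fx] cF]; split; first by exists (g x), x.
rewrite (_ : g @` F = h @^-1` F); first by apply: preimage_closed => // y _; exact: ch.
apply/seteqP; split=> [_ [y Fy <-]|y hy]; first by rewrite /preimage /= gK.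
by exists (h y); rewrite ?hK.
Qed.

Lemma is_chain_act (g : X -> X) c : homeo g -> is_chain c -> is_chain [set g @` F | F in c].
Proof.
move=> hg [cE cc]; split; first by move=> _ [F /cE EF <-]; exact: ExpS_image.
move=> _ _ [E cE' <-] [F cF <-]; case: (cc E F cE' cF) => s; [left|right]; exact: image_subset.
Qed.

Lemma phi_act_mem (g : X -> X) (c : Exp2 X) : homeo g -> Phi c -> Phi (phi_act g c).
Proof.
move=> hg [cc mc]; split; first exact: is_chain_act.
move=> d cd sd; have [h [hh' gK hK]] := homeo_inv hg.
have e : [set h @` F | F in d] = c.
  apply: mc; first exact: is_chain_act.
  move=> F cF; exists (g @` F); last exact: image_cancel.
  by apply: sd; exists F.
apply/seteqP; split=> // F dF; exists (h @` F); last exact: image_cancel.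
by rewrite -e; exists F.
Qed.

Lemma phi_act1 (c : Exp2 X) : phi_act idfun c = c.
Proof.
apply/seteqP; split=> [_ [F cF <-]|F cF]; first by rewrite image_id.
by exists F => //; rewrite image_id.
Qed.

Lemma phi_actM (g h : X -> X) (c : Exp2 X) : phi_act (g \o h) c = phi_act g (phi_act h c).
Proof.
apply/seteqP; split=> [_ [F cF <-]|_ [_ [F cF <-] <-]].
  by exists (h @` F); [exists F|rewrite image_comp].
by exists F => //; rewrite image_comp.
Qed.

(** The preimage of a clopen set is compact, so that mapping it into that set is an open condition
    on [h]. It is used for [A] and for its complement. *)
Lemma preimage_near (g : {compact-open, X -> X}) A : continuous (g : X -> X) -> clopen A ->
  \forall h \near g, (h : X -> X) @^-1` A = (g : X -> X) @^-1` A.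
Proof.
move=> cg.
have key B : clopen B -> \forall h \near g, (g : X -> X) @^-1` B `<=` (h : X -> X) @^-1` B.
  move=> [oB clB].
  have : nbhs g [set h : {compact-open, X -> X} | (h : X -> X) @` ((g : X -> X) @^-1` B) `<=` B].
    apply: open_nbhs_nbhs; split; last by move=> _ [x Bx <-].
    apply: compact_open_open => //; apply: closed_compactX.
    by apply: preimage_closed => // y _; exact: cg.
  by apply: filterS => h hB x Bx; apply: hB; exists x.
move=> clA; apply: filterS2 (key A clA) (key _ (clopenC setT clA)) => h h1 h2.
apply/seteqP; split=> // x hx; apply: contrapT => gx.
exact: (h2 x gx).
Qed.

Lemma phi_act_continuous :
  {within [set p : ({compact-open, X -> X} * Exp2 X)%type | homeo p.1 /\ @Phi X p.2],
        continuous (fun p : ({compact-open, X -> X} * Exp2 X)%type => phi_act p.1 p.2)}.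
Proof.
apply/subspace_continuousP => -[g c] [/= hg pc].
apply: phi_cvg; [ |exact: phi_act_mem|].
  by apply: (filterS _ (@withinT _ _ _ _)) => -[h d] [/= hh' pd]; exact: phi_act_mem.
move=> A B clA clB.
have [cg _] := hg.
have nA := preimage_near cg clA; have nB := preimage_near cg clB.
have nc := cle_near pc (preimage_homeo hg clA) (preimage_homeo hg clB).
exists ([set h : {compact-open, X -> X} | (h : X -> X) @^-1` A = g @^-1` A /\
    (h : X -> X) @^-1` B = g @^-1` B],
  [set d : Exp2 X | Phi d -> cle d (g @^-1` A) (g @^-1` B) <-> cle c (g @^-1` A) (g @^-1` B)]).
  by split=> //; exact: filterI nA nB.
move=> [h d] [/= [eA eB] hd] [_ /= pd].
apply: (iff_trans (cle_act _ _ _ _)); apply: iff_sym; apply: (iff_trans (cle_act _ _ _ _)).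
by rewrite eA eB; apply: iff_sym; exact: hd.
Qed.

Lemma phi_nonempty : @Phi X !=set0.
Proof.
have [|c [cc mc]] := @Zorn_bigcup (set X) (@is_chain X).
  move=> S SP tS; split; first by move=> F [c Sc cF]; exact: (proj1 (SP c Sc)).
  move=> E F [c Sc cE] [d Sd dF]; case: (tS c d Sc Sd) => s.
    by apply: (proj2 (SP d Sd)) => //; exact: s.
  by apply: (proj2 (SP c Sc)) => //; exact: s.
exists c; split=> // d cd sd; apply: contrapT => ne; apply: (mc d) => //.
by rewrite properEneq; split=> //; apply/eqP => e; apply: ne.
Qed.

(** If [p] gives a basic neighbourhood of [c], relabelling [p] to be sorted by [d] and moving it
    back by a homeomorphism [g] brings [phi_act g d] into that neighbourhood. *)
Lemma phi_minimal : minimal_G_space (@Phi X) (@phi_act X).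
Proof.
split; first exact: phi_nonempty.
move=> S [sS iS] [d Sd] clS; apply/seteqP; split=> // c pc.
pose c' : set_type (@Phi X) := exist _ c (mem_set pc).
suff : closure (set_val @^-1` S : set (set_type (@Phi X))) c' by move/clS.
move=> V; rewrite nbhsE => -[O [[W oW WO] Oc'] OV].
have nW : nbhs c W by apply: open_nbhs_nbhs; split=> //; move: Oc'; rewrite -WO.
have [n [p [lp sp pW]]] := phi_base pc nW.
have [q [s [t [lq sq _ _]]]] := csorted_relabel (sS _ Sd) lp.
have [g hg pg] := lpart_transitive lp lq.
have Sgd := iS _ _ hg Sd; have pgd := sS _ Sgd.
exists (exist _ (phi_act g d) (mem_set pgd)); split; first exact: Sgd.
apply: OV; rewrite -WO /=; apply: pW => //.
by apply/csorted_act; rewrite pg.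
Qed.

Lemma phi_G_space : is_G_space (@Phi X) (@phi_act X).
Proof.
split; [exact: compact_phi|exact: hausdorff_phi|by move=> g c; exact: phi_act_mem|].
split; [by move=> c _; exact: phi_act1|by move=> g h c _ _ _; exact: phi_actM|].
exact: phi_act_continuous.
Qed.
(** * Chains and parameter words *)

Lemma rg_intro a w b : a <= b -> (forall x, x \in w -> x < b) ->
  (forall v, a <= v < b -> v \in w) ->
  (forall j v, j < size w -> a <= v < nth 0 w j -> v \in take j w) -> rg a w b.
Proof.
elim: w a => [|x w IH] a ab wb sw fw /=.
  rewrite eqn_leq ab /= leqNgt; apply/negP => h.
  by have := sw a; rewrite leqnn h => /(_ isT).
have xa : x <= a.
  by rewrite leqNgt; apply/negP => ax; have := fw 0 a isT; rewrite leqnn ax => /(_ isT).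
have wb' y : y \in w -> y < b by move=> yw; apply: wb; rewrite inE yw orbT.
case: ltnP => xa'; last first.
  have e : x = a by apply/eqP; rewrite eqn_leq xa xa'.
  subst x; rewrite eqxx /=; apply: IH => //; first exact: (wb a (mem_head _ _)).
    move=> v /andP[av vb]; have := sw v; rewrite vb (ltnW av) => /(_ isT).
    by rewrite inE => /orP[/eqP e|//]; rewrite e ltnn in av.
  move=> j v jw /andP[av vj]; have := fw j.+1 v jw; rewrite /= vj (ltnW av) => /(_ isT).
  by rewrite inE => /orP[/eqP e|//]; rewrite e ltnn in av.
apply: IH => //.
  move=> v /andP[av vb]; have := sw v; rewrite vb av => /(_ isT).
  by rewrite inE => /orP[/eqP e|//]; rewrite e leqNgt xa' in av.
move=> j v jw /andP[av vj]; have := fw j.+1 v jw; rewrite /= vj av => /(_ isT).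
by rewrite inE => /orP[/eqP e|//]; rewrite e leqNgt xa' in av.
Qed.

(** Links chains with parameter words: smaller labels of [s \o b] are met earlier by the chain, so
    they occur earlier in the list of values of [s]. *)
Lemma csorted_rg c N b n (s : nat -> nat) : maximal_chain c -> lpart N b -> csorted c N b ->
  lpart n (s \o b) -> csorted c n (s \o b) -> rg 0 (mkseq s N) n.
Proof.
move=> mc lb sb [_ sn sm] ss; have [_ bn bm] := lb.
apply: rg_intro => //.
- move=> x /mapP[j]; rewrite mem_iota /= => jN ->; have [y <-] := bm j jN; exact: sn.
- move=> v /andP[_ /sm[x <-]]; apply: map_f; rewrite mem_iota /=; exact: bn.
move=> j v; rewrite size_mkseq => jN; rewrite nth_mkseq //= => vj.
have nc : ~ cle c (b @^-1` (s @^-1` [set s j])) (b @^-1` (s @^-1` [set v])).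
  by apply: (ss v (s j)); rewrite vj; have [x <-] := bm j jN; exact: sn.
have [h|//] := cle_total (b @^-1` (s @^-1` [set v])) (b @^-1` (s @^-1` [set s j])) (proj1 mc).
have [i si ij] := (csorted_cle _ _ mc lb sb).1 h j erefl jN.
have {}ij : i < j.
  by rewrite ltn_neqAle ij andbT; apply/eqP => e; move: vj; rewrite -si e ltnn.
rewrite /mkseq -map_take take_iota -si; apply: map_f.
by rewrite mem_iota /= leq_min ij (ltn_trans ij jN).
Qed.

Lemma rg_lpart M r N f : lpart M r -> size f = M -> rg 0 f N ->
  lpart N (nth 0 f \o r).
Proof.
move=> lr sf rf; have [cr rM rm] := lr; split.
- by move=> i; apply: (lpart_preimage (nth 0 f @^-1` [set i]) lr).
- by move=> x /=; apply: rg_lt rf (mem_nth _ _); rewrite sf.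
move=> i iN; have [//|p [q [ef _ _]]] := rg_split (x := i) rf.
have [|x rx] := rm (size p); first by rewrite -sf ef size_cat /= -addSnnS leq_addr.
by exists x; rewrite /= rx ef nth_cat ltnn subnn.
Qed.

Lemma lpart_comp n p (g : X -> X) : homeo g -> lpart n p -> lpart n (p \o g).
Proof.
move=> hg [cp pn pm]; have [h [_ gK hK]] := homeo_inv hg; split.
- by move=> i; apply: (preimage_homeo hg (cp i)).
- by move=> x; apply: pn.
by move=> i /pm[x <-]; exists (h x); rewrite /= hK.
Qed.

Lemma split_clopen A C x1 : clopen A -> A !=set0 -> clopen C -> C x0 -> ~ C x1 ->
  exists B, [/\ clopen B, B `<=` A, B !=set0 & (A `\` B) !=set0].
Proof.
move=> clA A0 clC Cx0 Cx1; have [f [g [cf cg gf fg]]] := hh clA A0.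
have oA := proj1 clA; move: cf; rewrite continuous_open_subspace // => cf.
have op := (continuous_inP f oA).1 cf.
have e : ~` (A `&` f @^-1` C) = ~` A `|` (A `&` f @^-1` (~` C)).
  apply/seteqP; split=> y /=; last by case=> [nA []//|[_ nC] [_ /nC]].
  by move=> n; have [Ay|] := pselect (A y); [right; split=> // Cy; apply: n|left].
exists (A `&` f @^-1` C); split.
- split; first by apply: op; case: clC.
  rewrite -openC e; apply: openU; first by apply: closed_openC; case: clA.
  by apply: op; apply: closed_openC; case: clC.
- by move=> y [].
- by exists (g x0); have [h1 h2] := fg x0; split=> //; rewrite /preimage /= h2.
- by exists (g x1); have [h1 h2] := fg x1; split=> // -[_]; rewrite /preimage /= h2.
Qed.

Lemma lpart_exists x1 M : x0 <> x1 -> 0 < M -> exists p, lpart M p.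
Proof.
move=> x01; have [C [clC Cx0 Cx1]] : exists C, [/\ clopen C, C x0 & ~ C x1].
  have nx1 : ~ [set x1] x0 by [].
  have cl1 : closed [set x1] by exact: accessible_closed_set1 (hausdorff_accessible hX) x1.
  have [C [clC Cx0 C1]] := separate_clopen cl1 nx1; exists C; split=> // Cx1.
  by have : ([set x1] `&` C) x1 by []; rewrite C1.
case: M => // M _; elim: M => [|M [p [cp pn pm]]].
  exists (fun=> 0); split=> //; last by move=> [|//] _; exists x0.
  move=> [|i]; last by rewrite (_ : _ @^-1` _ = set0); [exact: clopen0|rewrite -subset0].
  by rewrite (_ : _ @^-1` _ = setT); [exact: clopenT|apply/seteqP; split].
have [x px] := pm 0 isT.
have [B [clB Bp [y By] [z [pz Bz]]]] :=
  split_clopen (cp 0) (ex_intro _ x px) clC Cx0 Cx1.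
(* The piece labelled 0 is split, and the part [B] gets the new label. *)
pose p' x := if x \in B then M.+1 else p x.
have pB u : B u -> p' u = M.+1 by move=> Bu; rewrite /p' mem_set.
have pnB u : ~ B u -> p' u = p u by move=> nB; rewrite /p' memNset.
exists p'; split.
- move=> i; have [->|iM] := eqVneq i M.+1.
    rewrite (_ : p' @^-1` _ = B) //; apply/seteqP; split=> u; last exact: pB.
    move=> e; apply: contrapT => nB; have := pn u; rewrite -pnB // e ltnn //.
  rewrite (_ : p' @^-1` _ = p @^-1` [set i] `\` B); first exact: clopenD.
  apply/seteqP; split=> u /=; last by case=> <- /pnB.
  have [Bu|nB] := pselect (B u); last by rewrite pnB.
  by rewrite pB // => e; rewrite -e eqxx in iM.
- move=> u; have [Bu|nB] := pselect (B u); first by rewrite pB.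
  by rewrite pnB //; apply: ltn_trans (pn u) _.
move=> i; rewrite ltnS leq_eqVlt => /orP[/eqP->|]; first by exists y; exact: pB.
case: i => [_|i iM]; first by exists z; rewrite pnB.
have [u pu] := pm _ iM; exists u; rewrite pnB // => /Bp /=; by rewrite /preimage /= pu.
Qed.

Lemma join_family c r (m : nat -> nat) (P : nat -> X -> nat) : maximal_chain c ->
  (forall i, i < r -> lpart (m i) (P i)) ->
  exists N b, [/\ lpart N b, csorted c N b &
    forall i, i < r -> exists s : nat -> nat, P i = s \o b].
Proof.
move=> mc; elim: r => [|r IH] lP.
  by have [n [q [_ [lq sq _]]]] := clopen_sorted mc clopenT; exists n, q.
have [|N [b [lb sb hb]]] := IH; first by move=> i ir; apply: lP; exact: ltnW.
have [N' [b' [s [t [lb' sb' e1 e2]]]]] := join_sorted mc lb (lP r (ltnSn r)).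
exists N', b'; split=> // i; rewrite ltnS leq_eqVlt => /orP[/eqP->|/hb[s' ->]].
  by exists t.
by exists (s' \o s); rewrite e1.
Qed.

(** * The map onto a minimal space *)

Section Factor.
Context (Y : topologicalType) (act : (X -> X) -> Y -> Y).
Hypotheses (GY : is_G_space [set: Y] act) (mY : minimal_G_space [set: Y] act).

Lemma compactY : compact [set: Y]. Proof. by case: GY. Qed.

Lemma act1 y : act idfun y = y. Proof. by case: GY => _ _ _ [h _ _]; exact: h. Qed.

Lemma actM g h y : homeo g -> homeo h -> act (g \o h) y = act g (act h y).
Proof. by move=> hg hh'; case: GY => _ _ _ [_ hM _]; exact: hM. Qed.

Lemma hausdorffY : hausdorff_space Y.
Proof.
case: GY => _ hY _ _ p q cl.
pose i y : set_type [set: Y] := exist _ y (mem_set I).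
suff : i p = i q by move/(congr1 set_val).
apply: hY => A B.
have key y (V : set (set_type [set: Y])) : nbhs (i y) V -> nbhs y [set z | V (i z)].
  rewrite nbhsE => -[_ [[W oW <-] Wy] WV].
  by exists W => // z Wz; apply: WV.
by move=> /key nA /key nB; have [y [Ay By]] := cl _ _ nA nB; exists (i y).
Qed.

Lemma act_near (g : {compact-open, X -> X}) z (O : set Y) : homeo (g : X -> X) ->
  nbhs (act g z) O ->
  exists2 P : set {compact-open, X -> X}, nbhs g P & exists2 Q, nbhs z Q &
    forall h y, P h -> Q y -> homeo (h : X -> X) -> O (act h y).
Proof.
move=> hg nO; case: GY => _ _ _ [_ _ /subspace_continuousP/(_ (g, z))].
move=> /(_ (conj hg I) O nO) [[P Q] /= [nP nQ] PQ].
exists P => //; exists Q => // h y Ph Qy hh'.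
exact: (PQ (h, y) (conj Ph Qy) (conj hh' I)).
Qed.

Lemma act_continuous g : homeo g -> continuous (act g).
Proof.
move=> hg z O /(act_near hg)[P nP [Q nQ PQ]].
by apply: filterS nQ => y Qy; apply: PQ => //; exact: nbhs_singleton nP.
Qed.

(** Between a compact [K] and an open [O] there is a clopen [W]. A map preserving a partition of
    which [W] is a union of pieces sends [K] into [O]. *)
Lemma identity_base (P : set {compact-open, X -> X}) : nbhs (idfun : {compact-open, X -> X}) P ->
  exists n p, lpart n p /\ forall g : X -> X, p \o g = p -> P g.
Proof.
have [c0 pc] := phi_nonempty.
pose B (np : nat * (X -> nat)) : set {compact-open, X -> X} := [set g | np.2 \o g = np.2].
have FF : Filter (filter_from [set np | lpart np.1 np.2] B).
  apply: filter_from_filter.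
    by have [n [q [_ [lq _ _]]]] := clopen_sorted pc clopenT; exists (n, q).
  move=> [n1 p1] [n2 p2] /= lp1 lp2.
  have [n [q [s [t [lq _ e1 e2]]]]] := join_sorted pc lp1 lp2.
  exists (n, q) => // g /= qg; split; rewrite /B /= ?e1 ?e2; apply/funext => x /=;
    by rewrite -[q (g x)]/((q \o g) x) qg.
move=> nP; suff [[n p] /= lp BP] : filter_from [set np | lpart np.1 np.2] B P.
  by exists n, p; split=> // g pg; exact: BP.
move: P nP; apply/compact_open_cvgP => K O cK oO KO.
have KO' : K `<=` O by move=> x Kx; apply: KO; exists x.
have [W [clW KW WO]] := clopen_between (compact_closed hX cK) oO KO'.
have [n [q [S [lq _ eW]]]] := clopen_sorted pc clW.
exists (n, q) => // g /= qg _ [x Kx <-]; apply: WO; move: (KW x Kx); rewrite eW /preimage /=.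
by rewrite -[q (g x)]/((q \o g) x) qg.
Qed.

(* [p] is fine enough that the [p]-stabiliser never moves a point from [K2] to [K1]. *)
Definition separating p (K1 K2 : set Y) := forall y g1 g2, homeo g1 -> homeo g2 ->
  p \o g1 = p \o g2 -> K1 (act g1 y) -> ~ K2 (act g2 y).

Lemma separating_refine p q (s : nat -> nat) (K1 K2 : set Y) : p = s \o q ->
  separating p K1 K2 -> separating q K1 K2.
Proof.
move=> -> sp y g1 g2 h1 h2 e; apply: sp => //.
exact: (congr1 (comp s) e).
Qed.

(** Otherwise the points of [K2] moved into [K1] by stabilisers of ever finer partitions cluster at
    some [z] in [K2]. Joint continuity at the identity and [z] contradicts this. *)
Lemma exists_separating (K1 K2 : set Y) : closed K1 -> closed K2 -> K1 `&` K2 = set0 ->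
  exists n p, lpart n p /\ separating p K1 K2.
Proof.
move=> c1 c2 K12; apply: contrapT => nex.
pose B (np : nat * (X -> nat)) : set Y :=
  [set z | K2 z /\ exists k, [/\ homeo k, np.2 \o k = np.2 & K1 (act k z)]].
have [d pd] := phi_nonempty.
have GG : ProperFilter (filter_from [set np | lpart np.1 np.2] B).
  apply: filter_from_proper.
    apply: filter_from_filter.
      by have [n [q [_ [lq _ _]]]] := clopen_sorted pd clopenT; exists (n, q).
    move=> [n1 p1] [n2 p2] /= lp1 lp2.
    have [n [q [s [t [lq _ -> ->]]]]] := join_sorted pd lp1 lp2.
    exists (n, q) => // z [K2z [k [hk qk K1z]]]; split; split=> //; exists k; split=> //=.
      exact: (congr1 (comp s) qk).
    exact: (congr1 (comp t) qk).
  move=> [n p] /= lp; apply: contrapT => B0; apply: nex; exists n, p; split=> //.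
  move=> y g1 g2 h1 h2 e K1y K2y; apply: B0; exists (act g2 y); split=> //.
  have [k [hk gK kK]] := homeo_inv h2.
  (* With [k] the inverse of [g2], this map stabilises [p] and sends [act g2 y] to [act g1 y]. *)
  exists (g1 \o k); split; first exact: homeo_comp.
    by rewrite /= -[LHS]/((p \o g1) \o k) e; apply/funext => x /=; rewrite kK.
  rewrite -actM //; last exact: homeo_comp.
  by rewrite (_ : (g1 \o k) \o g2 = g1) //; apply/funext => x /=; rewrite gK.
have [z [_]] := compactY GG (@filterT _ _ _).
rewrite clusterE => clz.
have K2z : K2 z.
  have [n [q [_ [lq _ _]]]] := clopen_sorted pd clopenT.
  apply: c2; apply: closureS (clz (B (n, q)) _); first by move=> ? [].
  by exists (n, q).
have nK1 : nbhs (act idfun z) (~` K1).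
  rewrite act1; apply: open_nbhs_nbhs; split; first exact: closed_openC.
  by move=> K1z; have : (K1 `&` K2) z by []; rewrite K12.
have [P nP [Q nQ PQ]] := act_near homeo_id nK1.
have [n [p [lp hP]]] := identity_base nP.
have [|y [[_ [k [hk pk K1y]]] Qy]] := clz (B (n, p)) _ Q nQ; first by exists (n, p).
exact: PQ _ _ (hP _ pk) Qy hk K1y.
Qed.

Lemma lpart_gt0 n p : lpart n p -> 0 < n.
Proof. by move=> [_ pn _]; apply: leq_ltn_trans (pn x0). Qed.

(** * A generic point of the minimal space, and limits along its orbit *)

Section Generic.
Variable c0 : Exp2 X.
Hypothesis pc0 : Phi c0.

Record condition := Condition {
  cond_U1 : set Y; cond_U2 : set Y; cond_n : nat; cond_p : X -> nat;
  cond_g : X -> X; cond_h : X -> X }.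

Definition valid_condition t := [/\ lpart (cond_n t) (cond_p t),
  separating (cond_p t) (closure (cond_U1 t)) (closure (cond_U2 t)),
  open (cond_U1 t) /\ open (cond_U2 t),
  homeo (cond_g t) /\ csorted c0 (cond_n t) (cond_p t \o cond_g t) &
  homeo (cond_h t) /\ csorted c0 (cond_n t) (cond_p t \o cond_h t)].

Definition satisfies y t :=
  ~ (cond_U1 t (act (cond_g t) y) /\ cond_U2 t (act (cond_h t) y)).

Lemma finitely_satisfiable r (t : nat -> condition) :
  (forall i, i < r -> valid_condition (t i)) ->
  exists y, forall i, i < r -> satisfies y (t i).
Proof.
move=> vt; have [y0 _] : [set: Y] !=set0 by case: mY.
(* Partitions of arbitrary size need two points. If [x0] is the only one, the two maps of a
   condition coincide, and [separating] applies to equal maps. *)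
have [[x1 x01]|single] := pselect (exists x1, x0 <> x1); last first.
  exists y0 => i ir [U1g U2h]; have [lp sp _ [hg _] [hh' _]] := vt i ir.
  have e : cond_g (t i) = cond_h (t i).
    apply/funext => x; have all0 z : z = x0.
      by apply: contrapT => zx; apply: single; exists z => /esym.
    by rewrite (all0 (cond_g _ x)) (all0 (cond_h _ x)).
  apply: (sp y0 (cond_g (t i)) (cond_h (t i)) hg hh').
  - by rewrite e.
  - exact: subset_closure.
  - exact: subset_closure.
have [i ir|N1 [b1 [lb1 sb1 hb1]]] :=
    @join_family c0 r (fun i => cond_n (t i)) (fun i => cond_p (t i) \o cond_g (t i)) pc0.
  by have [lp _ _ [hg _] _] := vt i ir; exact: lpart_comp.
have [i ir|N2 [b2 [lb2 sb2 hb2]]] :=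
    @join_family c0 r (fun i => cond_n (t i)) (fun i => cond_p (t i) \o cond_h (t i)) pc0.
  by have [lp _ _ _ [hg _]] := vt i ir; exact: lpart_comp.
(* One [c0]-increasing partition [b] refines all those occurring in the conditions. *)
have [N [b [s1 [s2 [lb sb e1 e2]]]]] := join_sorted pc0 lb1 lb2.
have [M hM] := dual_ramsey N {ffun 'I_r -> bool}.
have M0 : 0 < M.
  have [f [sf rf _]] := hM (fun=> [ffun=> true]).
  by apply: leq_trans (lpart_gt0 lb) _; have := rg_size rf; rewrite sf.
(* Colour the words [w] by whether the labelled partition [w o c] allows the
   orbit of [y0] to meet [closure U1]; the dual Ramsey word [f] gives a
   partition [f o c] of size [N], and [k] carries it to [b]. *)
have [c lc] := lpart_exists x01 M0.
pose chi (w : seq nat) := [ffun i : 'I_r => `[< exists g, [/\ homeo g,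
  cond_p (t i) \o g = nth 0 w \o c & closure (cond_U1 (t i)) (act g y0)] >]].
have [f [sf rf hf]] := hM chi.
have [k hk bk] := lpart_transitive lb (rg_lpart lc sf rf).
exists (act k y0) => i ir [U1y U2y].
have [lp sp _ [hg sg] [hh' sh]] := vt i ir.
have [u1 eu1] := hb1 i ir; have [u2 eu2] := hb2 i ir.
(* These words express the two partitions of the condition through the labels of [b]. Since all of
   them are [c0]-increasing, they are parameter words with the same number of letters. *)
pose w1 := mkseq (u1 \o s1) N; pose w2 := mkseq (u2 \o s2) N.
have eg : cond_p (t i) \o cond_g (t i) = (u1 \o s1) \o b by rewrite eu1 e1.
have eh : cond_p (t i) \o cond_h (t i) = (u2 \o s2) \o b by rewrite eu2 e2.
have word (u : nat -> nat) g : cond_p (t i) \o g = u \o b ->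
    cond_p (t i) \o (g \o k) = nth 0 (sub 0 (mkseq u N) f) \o c.
  move=> eg'; rewrite -[LHS]/((cond_p (t i) \o g) \o k) eg'.
  rewrite -[LHS]/(u \o (b \o k)) bk; apply/funext => x /=.
  have [_ cM _] := lc; rewrite (nth_map 0) ?sf // nth_mkseq //.
  by apply: rg_lt rf _; apply: mem_nth; rewrite sf.
have r1 : rg 0 w1 (cond_n (t i)).
  by apply: (csorted_rg pc0 lb sb); rewrite -eg //; exact: lpart_comp.
have r2 : rg 0 w2 (cond_n (t i)).
  by apply: (csorted_rg pc0 lb sb); rewrite -eh //; exact: lpart_comp.
have := hf _ w1 w2 (size_mkseq _ _) (size_mkseq _ _) r1 r2.
move=> /ffunP/(_ (Ordinal ir)); rewrite !ffunE /= => e.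
have : `[< exists g, [/\ homeo g, cond_p (t i) \o g = nth 0 (sub 0 w1 f) \o c &
    closure (cond_U1 (t i)) (act g y0)] >].
  apply/asboolP; exists (cond_g (t i) \o k); split; [exact: homeo_comp|exact: word|].
  by rewrite actM //; exact: subset_closure.
(* Equality of colours yields a [g] which agrees with [cond_h (t i) \o k] after [cond_p (t i)] and
   moves [y0] into the closure of [U1]. *)
rewrite e => /asboolP[g [hg' eg' U1g]].
apply: (sp y0 g (cond_h (t i) \o k)) => //; first exact: homeo_comp.
  by rewrite eg' (word _ _ eh).
by rewrite actM //; exact: subset_closure.
Qed.

(** Each condition is closed in [y], as [U1] and [U2] are open and the action is continuous;
    compactness passes from finite families to all conditions. *)
Lemma exists_generic : exists y, forall U1 U2 n p, open U1 -> open U2 -> lpart n p ->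
  separating p (closure U1) (closure U2) ->
  forall g h, homeo g -> homeo h -> csorted c0 n (p \o g) -> csorted c0 n (p \o h) ->
    U1 (act g y) -> ~ U2 (act h y).
Proof.
pose D := [set rt : nat * (nat -> condition) | forall i, i < rt.1 -> valid_condition (rt.2 i)].
pose B (rt : nat * (nat -> condition)) := [set y | forall i, i < rt.1 -> satisfies y (rt.2 i)].
have [y0 _] : [set: Y] !=set0 by case: mY.
pose t0 := Condition set0 set0 0 (fun=> 0) idfun idfun.
have GG : ProperFilter (filter_from D B).
  apply: filter_from_proper; last by move=> [r t] /= /finitely_satisfiable.
  apply: filter_from_filter; first by exists (0, fun=> t0).
  move=> [r1 t1] [r2 t2] /= v1 v2.
  exists (r1 + r2, fun i => if i < r1 then t1 i else t2 (i - r1)).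
    move=> i /=; case: (ltnP i r1) => [ir _|ri]; first exact: v1.
    by rewrite -{1}(subnKC ri) ltn_add2l; exact: v2.
  move=> y /= hy; split=> i /= ir.
    by have := hy i (ltn_addr _ ir); rewrite /= ir.
  by have := hy (r1 + i); rewrite /= ltn_add2l ir ltnNge leq_addr /= addKn; apply.
have [y [_]] := compactY GG (@filterT _ _ _).
rewrite clusterE => cly; exists y => U1 U2 n p o1 o2 lp sp g h hg hh' sg sh U1y U2y.
pose t := Condition U1 U2 n p g h.
have By : closure (B (1, fun=> t)) y by apply: cly; exists (1, fun=> t).
have n1 : nbhs y (act g @^-1` U1).
  by apply: (act_continuous hg); exact: open_nbhs_nbhs.
have n2 : nbhs y (act h @^-1` U2).
  by apply: (act_continuous hh'); exact: open_nbhs_nbhs.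
have [z [/(_ 0 isT) Bz [z1 z2]]] := By _ (filterI n1 n2).
exact: Bz.
Qed.

(* The points [g y] with [g c0] close to [c]. *)
Definition orbit_filter y (c : Exp2 X) : set_system Y :=
  filter_from [set nq : nat * (X -> nat) | lpart nq.1 nq.2 /\ csorted c nq.1 nq.2]
    (fun nq => [set z | exists g, [/\ homeo g, csorted c0 nq.1 (nq.2 \o g) & act g y = z]]).

Lemma orbit_filter_base y (c : Exp2 X) n q : lpart n q -> csorted c n q ->
  orbit_filter y c [set z | exists g, [/\ homeo g, csorted c0 n (q \o g) & act g y = z]].
Proof. by move=> lq sq; exists (n, q). Qed.

Lemma orbit_filter_proper y c : Phi c -> ProperFilter (orbit_filter y c).
Proof.
move=> pc; apply: filter_from_proper.
  apply: filter_from_filter.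
    by have [n [q [_ [lq sq _]]]] := clopen_sorted pc clopenT; exists (n, q).
  move=> [n1 p1] [n2 p2] [/= lp1 sp1] [/= lp2 sp2].
  have [n [q [s [t [lq sq e1 e2]]]]] := join_sorted pc lp1 lp2.
  have tr m p u g : p = u \o q -> csorted c m p -> homeo g -> csorted c0 n (q \o g) ->
      csorted c0 m (p \o g).
    move=> ep sp hg sqg; apply/csorted_act.
    apply: (csorted_coarsen pc _ lq sq _ ep sp); first exact: phi_act_mem.
    exact/csorted_act.
  exists (n, q) => // z [g [hg /= sg <-]]; split; exists g; split=> //=.
    exact: tr e1 sp1 hg sg.
  exact: tr e2 sp2 hg sg.
move=> [n q] [/= lq sq]; have [q' [_ [_ [lq' sq' _ _]]]] := csorted_relabel pc0 lq.
have [g hg e] := lpart_transitive lq lq'.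
by exists (act g y), g; split=> //=; rewrite e.
Qed.

Lemma separate_closures (z1 z2 : Y) : z1 <> z2 -> exists U1 U2 : set Y,
  [/\ open U1, open U2, U1 z1, U2 z2 & closure U1 `&` closure U2 = set0].
Proof.
move=> /eqP z12; have := hausdorffY; rewrite open_hausdorff => /(_ _ _ z12).
move=> [[A1 A2] /= [/set_mem A1z /set_mem A2z] [oA1 oA2 /eqP A12]].
have reg z (A : set Y) : open A -> A z -> exists U, [/\ open U, U z & closure U `<=` A].
  move=> oA Az; have [V nV VA] := compact_regular hausdorffY compactY (@filterT _ (nbhs z) _)
    (open_nbhs_nbhs (conj oA Az)).
  exists V°; split; [exact: open_interior|exact: nV|].
  by apply: subset_trans VA; apply: closureS; exact: interior_subset.
have [U1 [oU1 U1z UA1]] := reg _ _ oA1 A1z; have [U2 [oU2 U2z UA2]] := reg _ _ oA2 A2z.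
exists U1, U2; split=> //; rewrite -subset0 -A12; exact: setISS.
Qed.

(** Distinct cluster points have neighbourhoods with disjoint closures, separated by some partition.
    Once it is sorted by [c], the hypothesis on [y] forbids orbit points in both neighbourhoods. *)
Lemma orbit_filter_cluster_unique y c z1 z2 :
  (forall U1 U2 n p, open U1 -> open U2 -> lpart n p ->
    separating p (closure U1) (closure U2) ->
    forall g h, homeo g -> homeo h -> csorted c0 n (p \o g) -> csorted c0 n (p \o h) ->
      U1 (act g y) -> ~ U2 (act h y)) ->
  Phi c -> cluster (orbit_filter y c) z1 -> cluster (orbit_filter y c) z2 -> z1 = z2.
Proof.
move=> gen pc cl1 cl2; apply: contrapT => /separate_closures[U1 [U2 [o1 o2 U1z U2z U12]]].
have [n [p [lp sp]]] := exists_separating (@closed_closure _ U1) (@closed_closure _ U2) U12.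
have [q [s [_ [lq sq es _]]]] := csorted_relabel pc lp.
have {}sp := separating_refine es sp.
have FS := orbit_filter_base y lq sq.
have [_ [[g [hg /= sg <-]] U1g]] := cl1 _ U1 FS (open_nbhs_nbhs (conj o1 U1z)).
have [_ [[h [hh' /= sh <-]] U2h]] := cl2 _ U2 FS (open_nbhs_nbhs (conj o2 U2z)).
exact: gen o1 o2 lq sp g h hg hh' sg sh U1g U2h.
Qed.

End Generic.

Lemma exists_factor_map : exists f : Exp2 X -> Y,
  G_factor_map (@Phi X) [set: Y] (@phi_act X) act f.
Proof.
have [c0 pc0] := phi_nonempty; have [y gen] := exists_generic pc0.
(* [f c] is the unique cluster point of the orbit filter at [c], hence its limit. *)
have /choice[f hf] : forall c : Exp2 X, exists z, Phi c -> cluster (orbit_filter c0 y c) z.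
  move=> c; have [pc|npc] := pselect (Phi c); last by exists y.
  have PF := orbit_filter_proper pc0 y pc.
  have [z [_ clz]] := compactY PF (@filterT _ _ _); by exists z.
have uniq_f c z : Phi c -> cluster (orbit_filter c0 y c) z -> f c = z.
  by move=> pc; apply: orbit_filter_cluster_unique pc (hf c pc).
have cvf c : Phi c -> orbit_filter c0 y c --> f c.
  move=> pc; have PF := orbit_filter_proper pc0 y pc.
  apply: (compact_cluster_set1 hausdorffY compactY) => //; try exact: filterT.
  by apply/seteqP; split=> z /=; [move/(uniq_f c z pc)->|move->; exact: hf].
have cont : {within @Phi X, continuous f}.
  apply/subspace_continuousP => c pc O nO.
  have [V nV VO] := compact_regular hausdorffY compactY (@filterT _ (nbhs (f c)) _) nO.
  have [[n q] [/= lq sq] BV] := cvf c pc V nV.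
  (* Chains [d] near [c] sort the same [q], so their orbit filters contain the same set inside [V],
     and [f d] lies in its closure. *)
  have := csorted_near pc lq sq; rewrite /within /= => nc.
  apply: filterS nc => d /= h pd; apply: VO.
  apply: (closureS BV) => W nW.
  have FS := @orbit_filter_base c0 y d n q lq (h pd).
  exact: (hf d pd _ W FS nW).
have equiv g c : homeo g -> Phi c -> f (phi_act g c) = act g (f c).
  move=> hg pc; apply: uniq_f; first exact: phi_act_mem.
  move=> S N [[n q] [/= lq /csorted_act sq] BS] nN.
  have nN' : nbhs (f c) (act g @^-1` N) by exact: act_continuous.
  have FS := @orbit_filter_base c0 y c n (q \o g) (lpart_comp hg lq) sq.
  have [_ [[h [hh' /= sh <-]] Nh]] := hf c pc _ _ FS nN'.
  exists (act g (act h y)); split=> //; apply: BS; exists (g \o h); split=> //.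
    exact: homeo_comp.
  exact: actM.
exists f; split=> //.
have [_ mS] := mY.
(* The image is compact, hence closed, and it is invariant and nonempty. *)
have imf : f @` @Phi X = setT.
  apply: mS; first (split=> //).
  - by move=> g _ hg [c pc <-]; exists (phi_act g c); [exact: phi_act_mem|exact: equiv].
  - by exists (f c0), c0.
  apply: preimage_closed; first by move=> z _; exact: initial_continuous.
  apply: compact_closed; first exact: hausdorffY.
  by apply: continuous_compact => //; exact: compact_phi.
by move=> z _; have : (f @` @Phi X) z by rewrite imf.
Qed.

End Factor.

End Chains.

(* Phi(X), with the action g c = {gF : F in c}, is (isomorphic to) the
   universal minimal G-space M(G), G = Homeo(X) with the compact-open
   topology: it is a minimal G-space that maps onto every minimal G-space. *)
Theorem theorem4p1 (X : topologicalType) :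
  (exists x : X, True) ->
  compact [set: X] -> hausdorff_space X ->
  zero_dim X -> h_homogeneous X ->
  [/\ is_G_space (@Phi X) (@phi_act X),
      minimal_G_space (@Phi X) (@phi_act X) &
      forall (Y : topologicalType) (act : (X -> X) -> Y -> Y),
        is_G_space [set: Y] act -> minimal_G_space [set: Y] act ->
        exists f : Exp2 X -> Y,
          G_factor_map (@Phi X) [set: Y] (@phi_act X) act f].
Proof.
move=> [x0 _] cX hX zX hh; split.
- exact: phi_G_space.
- exact: phi_minimal.
- by move=> Y act GY mY; exact: exists_factor_map.
Qed.
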